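(* Let $V(f)\subset\mathbb{P}^r$ be a general P-hypersurface of type $(r,t,n)$. Then $Z(f)=W(f)\subset(\mathbb{P}^r)^*$, and therefore $z(f)=\min\{r-1,2(r-t)-1\}$.
   Context: $k$ is an algebraically closed field of characteristic $0$. P-hypersurfaces: let $r\ge2$ and $1\le t\le r-2$ be integers. Let $M_0,\dots,M_t\in k[x_{t+1},\dots,x_r]$ be forms of the same degree $n-1$ which are algebraically dependent over $k$. Set $Q=M_0x_0+\dots+M_tx_t$. Let $d>n$, $\mu=[d/n]$ (integer part), and let $P_k(x_{t+1},\dots,x_r)$, $k=0,\dots,\mu$, be forms of degree $d-kn$. The form $f=\sum_{k=0}^{\mu}Q^kP_k$ of degree $d$, or any form obtained from it by a linear change of variables, is a P-polynomial of type $(r,t,n)$, and $V(f)\subset\mathbb{P}^r$ is a P-hypersurface of type $(r,t,n)$, with core the $t$-dimensional subspace $\Pi:\ x_{t+1}=\dots=x_r=0$. It is general if the defining data are chosen sufficiently generally (subject to the algebraic dependence of $M_0,\dots,M_t$). For a linear subspace $\Sigma\subset\mathbb{P}^r$, $\Sigma^\perp\subset(\mathbb{P}^r)^*$ is the subspace of hyperplanes containing $\Sigma$. Let $\bar\Pi$ be the subspace $x_0=\dots=x_t=0$; for general $\xi\in\bar\Pi$ let $\Gamma_\xi\subset\Pi$ be the $(t-1)$-dimensional subspace with equation $M_0(\xi)x_0+\dots+M_t(\xi)x_t=0$ in $\Pi$. $W(f)\subset(\mathbb{P}^r)^*$ is the cone with vertex $\Pi^\perp$ described by the $(r-t)$-dimensional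 subspaces $\Gamma_\xi^\perp$ as $\xi$ varies in $\bar\Pi$. $Z(f)\subset(\mathbb{P}^r)^*$, the polar image, is the closure of the image of the polar map $\phi_f=(\partial f/\partial x_0:\dots:\partial f/\partial x_r):\mathbb{P}^r\dashrightarrow(\mathbb{P}^r)^*$, and $z(f)=\dim Z(f)$.
   Formalization: For n=1 (constant M_i) the formula for z(f) is asserted only when t=1, because for n=1 and t≥2 one has z(f)=r-t and the printed formula is false; Z(f)=W(f) is asserted for all n≥1. *)

(* Defs.v *)
(* Mathematical Components, with the multinomials library. *)
From HB Require Import structures.
From mathcomp Require Import all_boot all_order all_algebra.
From mathcomp Require Import mpoly.

Set Implicit Arguments.
Unset Strict Implicit.
Unset Printing Implicit Defensive.

Import GRing.Theory.
Local Open Scope ring_scope.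

(* A subset of the projective space P^(N-1) is encoded by the predicate on
   'rV[k]_N satisfied by the nonzero vectors representing its points; the same
   encoding, in dual coordinates, is used for subsets of the dual space. *)
Definition vset (k : closedFieldType) (N : nat) := 'rV[k]_N -> Prop.

Definition vincl (k : closedFieldType) (N : nat) (A B : vset k N) : Prop :=
  forall v, A v -> B v.

Definition vequal (k : closedFieldType) (N : nat) (A B : vset k N) : Prop :=
  forall v, A v <-> B v.

Definition proj_closed (k : closedFieldType) (N : nat) (A : vset k N) : Prop :=
  exists S : {mpoly k[N]} -> Prop,
    (forall p, S p -> exists e : nat, p \is e.-homog) /\
    (forall v, A v <-> v != 0 /\ forall p, S p -> p.@[v 0] = 0).

Definition proj_closure (k : closedFieldType) (N : nat) (A : vset k N) :
    vset k N :=
  fun v => v != 0 /\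
    forall (e : nat) (p : {mpoly k[N]}), p \is e.-homog ->
      (forall a, A a -> p.@[a 0] = 0) -> p.@[v 0] = 0.

Definition proj_irreducible_closed (k : closedFieldType) (N : nat)
    (A : vset k N) : Prop :=
  [/\ proj_closed A,
      exists v, A v
    & forall B C : vset k N, proj_closed B -> proj_closed C ->
        (forall v, A v -> B v \/ C v) -> vincl A B \/ vincl A C].

Definition irreducible_chain (k : closedFieldType) (N : nat) (A : vset k N)
    (l : nat) : Prop :=
  exists X : nat -> vset k N,
    (forall i, (i <= l)%N -> proj_irreducible_closed (X i) /\ vincl (X i) A) /\
    (forall i, (i < l)%N -> vincl (X i) (X i.+1) /\ ~ vincl (X i.+1) (X i)).

(* Krull dimension: the largest length of a strictly increasing chain of
   irreducible closed subsets. *)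
Definition has_dim (k : closedFieldType) (N : nat) (A : vset k N) (m : nat) :
    Prop :=
  irreducible_chain A m /\ forall l, irreducible_chain A l -> (l <= m)%N.

Definition polar (k : closedFieldType) (N : nat) (f : {mpoly k[N]})
    (x : 'rV[k]_N) : 'rV[k]_N :=
  \row_i (f^`M(i)).@[x 0].

Definition polar_image (k : closedFieldType) (N : nat) (f : {mpoly k[N]}) :
    vset k N :=
  proj_closure (fun y => y != 0 /\
    exists x c, [/\ x != 0, c != 0 & y = c *: polar f x]).

Definition perp (k : closedFieldType) (N : nat) (A : vset k N) : vset k N :=
  fun a => a != 0 /\ forall x, A x -> \sum_i a 0 i * x 0 i = 0.

Definition alg_dependent (k : closedFieldType) (N s : nat)
    (M : s.-tuple {mpoly k[N]}) : Prop :=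
  exists F : {mpoly k[s]}, F != 0 /\ F \mPo M = 0.

(* p lies in k[x_(t+1), ..., x_(N-1)]. *)
Definition in_last_vars (k : closedFieldType) (N t : nat) (p : {mpoly k[N]}) :
    Prop :=
  forall m : 'X_{1..N}, m \in msupp p ->
    forall i : 'I_N, (i <= t)%N -> m i = 0%N.

(* The defining data (M_0, ..., M_t; P_0, ..., P_mu), mu = [d / n]; the
   polynomials live in k[x_0, ..., x_r]. *)
Definition pdata (k : closedFieldType) (r t n d : nat) : Type :=
  (t.+1.-tuple {mpoly k[r.+1]} * (d %/ n).+1.-tuple {mpoly k[r.+1]})%type.

Definition is_pdata (k : closedFieldType) (r t n d : nat)
    (D : pdata k r t n d) : Prop :=
  [/\ forall i, tnth D.1 i \is (n - 1).-homog /\ in_last_vars t (tnth D.1 i),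
      alg_dependent D.1
    & forall j : 'I_(d %/ n).+1,
        tnth D.2 j \is (d - j * n).-homog /\ in_last_vars t (tnth D.2 j)].

Definition pQ (k : closedFieldType) (r t n d : nat) (D : pdata k r t n d) :
    {mpoly k[r.+1]} :=
  \sum_(i < t.+1) tnth D.1 i * 'X_(inord i).

Definition pform (k : closedFieldType) (r t n d : nat) (D : pdata k r t n d) :
    {mpoly k[r.+1]} :=
  \sum_(j < (d %/ n).+1) pQ D ^+ j * tnth D.2 j.

(* The form x |-> f (x *m g). *)
Definition lin_change (k : closedFieldType) (N : nat) (g : 'M[k]_N)
    (f : {mpoly k[N]}) : {mpoly k[N]} :=
  f \mPo [tuple \sum_(j < N) g j i *: 'X_j | i < N].

(* Pi, bar Pi, Gamma_xi and W for the form [lin_change g (pform D)]: the entries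
   of x *m g are the coordinates of x in which that form has the standard
   expression [pform D]. *)
Definition core (k : closedFieldType) (r t : nat) (g : 'M[k]_r.+1) :
    vset k r.+1 :=
  fun x => x != 0 /\ forall i : 'I_r.+1, (t < i)%N -> (x *m g) 0 i = 0.

Definition cocore (k : closedFieldType) (r t : nat) (g : 'M[k]_r.+1) :
    vset k r.+1 :=
  fun x => x != 0 /\ forall i : 'I_r.+1, (i <= t)%N -> (x *m g) 0 i = 0.

Definition Mval (k : closedFieldType) (r t n d : nat) (D : pdata k r t n d)
    (g : 'M[k]_r.+1) (xi : 'rV[k]_r.+1) (i : 'I_t.+1) : k :=
  (tnth D.1 i).@[(xi *m g) 0].

Definition Gamma (k : closedFieldType) (r t n d : nat) (D : pdata k r t n d)
    (g : 'M[k]_r.+1) (xi : 'rV[k]_r.+1) : vset k r.+1 :=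
  fun x => core t g x /\
    \sum_(i < t.+1) Mval D g xi i * (x *m g) 0 (inord i) = 0.

(* Gamma_xi has dimension t - 1 exactly when some M_i does not vanish at xi;
   these are the xi in bar Pi that are used. The cone is the closure of the
   union of the subspaces Gamma_xi^perp. *)
Definition Wcone (k : closedFieldType) (r t n d : nat) (D : pdata k r t n d)
    (g : 'M[k]_r.+1) : vset k r.+1 :=
  proj_closure (fun a => exists xi : 'rV[k]_r.+1,
    [/\ cocore t g xi, exists i, Mval D g xi i != 0
      & perp (Gamma D g xi) a]).

Definition zariski_closed (k : closedFieldType) (N : nat)
    (A : ('I_N -> k) -> Prop) : Prop :=
  exists S : {mpoly k[N]} -> Prop,
    forall v, A v <-> forall p, S p -> p.@[v] = 0.

(* Index set of the coefficients of the defining data: all of the polynomials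
   have degree at most d, since n - 1 < d. *)
Definition coef_index (r t n d : nat) : finType :=
  (('I_t.+1 + 'I_(d %/ n).+1) * 'X_{1..r.+1 < d.+1})%type.

Definition coefs (k : closedFieldType) (r t n d : nat) (D : pdata k r t n d) :
    'I_#|coef_index r t n d| -> k :=
  fun s =>
    let: (ij, m) := (enum_val s : coef_index r t n d) in
    match ij with
    | inl i => (tnth D.1 i)@_m
    | inr j => (tnth D.2 j)@_m
    end.

(* T holds for general defining data: it holds on a Zariski open dense subset
   of the (possibly reducible) variety of all defining data. Here A is the
   closed complement of the open set; density says that any closed B
   containing the open set contains the whole variety. *)
Definition for_general_pdata (k : closedFieldType) (r t n d : nat)
    (T : pdata k r t n d -> Prop) : Prop :=
  exists A : ('I_#|coef_index r t n d| -> k) -> Prop,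
    [/\ zariski_closed A,
        forall B : ('I_#|coef_index r t n d| -> k) -> Prop, zariski_closed B ->
          (forall D, is_pdata D -> ~ A (coefs D) -> B (coefs D)) ->
          forall D, is_pdata D -> B (coefs D)
      & forall D, is_pdata D -> ~ A (coefs D) -> T D].

(* Main.v *)
(** The first [t + 1] partial derivatives of [f] are [M_i R] for a common factor
    [R], so the polar image [Z] lies in the cone [W]. Both are irreducible, being
    closures of images of polynomial maps, so it is enough to compare dimensions.

    Upper bound for [W]: forms separating the members of a chain of irreducible
    closed subsets are algebraically independent on its top member, while more
    polynomials than variables are always dependent; [W] has, for [n > 1], a
    parametrization by [2 (r - t)] variables and lies on the hypersurface given by
    a relation between the [M_i]. Lower bound for [Z]: if the Hessian of [f] has
    rank [rho] at a point, the polar images of a flag of linear subspaces through a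
    general point form a chain of length [rho - 1].

    The bad set is the vanishing of the minors of size [rho = dim W + 1] of the
    Hessian. It is avoided by special [P_j] as soon as the Jacobian of the [M_i] has
    rank [min t (r - t)]; arbitrary data are reached along lines, raising the
    Jacobian rank one step at a time: below rank [t] any [t] of the [M_i] are
    dependent by the Jacobian criterion, so a redundant one can be moved freely. *)

(* One good choice of data would not give density: the variety of algebraically dependent tuples may
   be reducible, so every datum has to be joined to good ones by lines that stay inside that
   variety. The [P_j] move freely; the [M_i] may only move so that some relation survives.

   Write s = r - t. The good data have [P_j = 0] for j > 1, and their Hessian is taken at a point of
   bar Pi. There it has a zero block for the first t + 1 coordinates, a mixed block [B] built from
   [M_i P_1], and the Hessian of [P_0] as last block. A suitable [P_0] brings the rank up to rank
   [B] + s, and Euler's identity bounds rank [B] below by the Jacobian rank of the [M_i].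

   The case n = 1 stands apart: the [M_i] are constants, rescaling the argument no longer rescales
   them, and for non-zero [M] the cone W is a linear space of dimension s. This agrees with the
   stated minimum when t = 1. *)
Require Import Defs.
From HB Require Import structures.
From mathcomp Require Import all_boot all_order all_algebra.
From mathcomp Require Import mpoly.
From mathcomp Require Import zify ring.
From Stdlib Require Import Classical.

Set Implicit Arguments.
Unset Strict Implicit.
Unset Printing Implicit Defensive.

Import GRing.Theory.
Local Open Scope ring_scope.

(** * Multivariate polynomials *)

Section MPolyFacts.
Variable R : comNzRingType.

Lemma mpoly_ring_ind n (P : {mpoly R[n]} -> Prop) :
    (forall c, P c%:MP) -> (forall i, P 'X_i) ->
    (forall p q, P p -> P q -> P (p + q)) ->
    (forall p q, P p -> P q -> P (p * q)) ->
  forall p, P p.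
Proof.
move=> PC PX PD PM p; rewrite (mpolyE p).
elim/big_ind: _ => [||m _]; [by rewrite -mpolyC0 | exact: PD |].
rewrite -mul_mpolyC; apply: (PM) => //; rewrite mpolyXE_id.
elim/big_ind: _ => [||i _]; [by rewrite -mpolyC1 | exact: PM |].
by elim: (m i) => [|j IH]; rewrite ?expr0 -?mpolyC1 // exprS; apply: PM.
Qed.

(** Composition with a family indexed by a function rather than a tuple, so that families can be
    extended and reindexed without casts. *)
Definition msubst n N (g : 'I_n -> {mpoly R[N]}) (F : {mpoly R[n]}) :
    {mpoly R[N]} := mmap (@mpolyC N R) g F.

HB.instance Definition _ n N (g : 'I_n -> {mpoly R[N]}) :=
  GRing.RMorphism.copy (msubst g) (mmap (@mpolyC N R) g).

Lemma msubstC n N (g : 'I_n -> {mpoly R[N]}) c : msubst g c%:MP = c%:MP.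
Proof. exact: mmapC. Qed.

Lemma msubstX n N (g : 'I_n -> {mpoly R[N]}) i : msubst g 'X_i = g i.
Proof. by rewrite /msubst mmapX mmap1U. Qed.

Lemma msubstZ n N (g : 'I_n -> {mpoly R[N]}) c F :
  msubst g (c *: F) = c *: msubst g F.
Proof. by rewrite -!mul_mpolyC rmorphM /= msubstC. Qed.

Lemma comp_msubst n N (T : n.-tuple {mpoly R[N]}) F :
  F \mPo T = msubst (tnth T) F.
Proof. by []. Qed.

Lemma meval_msubst n N (g : 'I_n -> {mpoly R[N]}) F v :
  (msubst g F).@[v] = F.@[fun i => (g i).@[v]].
Proof.
elim/mpoly_ring_ind: F => [c|i|p q IHp IHq|p q IHp IHq].
- by rewrite msubstC !mevalC.
- by rewrite msubstX mevalXU.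
- by rewrite rmorphD /= !mevalD IHp IHq.
- by rewrite rmorphM /= !mevalM IHp IHq.
Qed.

Lemma eq_msubst n N (g h : 'I_n -> {mpoly R[N]}) F :
  g =1 h -> msubst g F = msubst h F.
Proof.
move=> E; elim/mpoly_ring_ind: F => [c|i|p q IHp IHq|p q IHp IHq].
- by rewrite !msubstC.
- by rewrite !msubstX E.
- by rewrite !rmorphD /= IHp IHq.
- by rewrite !rmorphM /= IHp IHq.
Qed.

Lemma mderivXU n (i j : 'I_n) : ('X_i : {mpoly R[n]})^`M(j) = (i == j)%:R.
Proof.
rewrite mderivX mnm1E; have [<-|_] := eqVneq; last by rewrite scale0r.
have -> : (U_(i) - U_(i) = 0)%MM by apply/mnmP=> a; rewrite mnmBE subnn mnm0E.
by rewrite mpolyX0 scale1r.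
Qed.

Lemma mderiv_msubst n N (g : 'I_n -> {mpoly R[N]}) F j :
  (msubst g F)^`M(j) = \sum_i msubst g F^`M(i) * (g i)^`M(j).
Proof.
elim/mpoly_ring_ind: F => [c|i|p q IHp IHq|p q IHp IHq].
- rewrite msubstC mderivC big1 // => i _.
  by rewrite mderivC rmorph0 mul0r.
- rewrite msubstX (bigD1 i) //= mderivXU eqxx rmorph1 mul1r big1 ?addr0 // => a ne.
  by rewrite mderivXU eq_sym (negPf ne) rmorph0 mul0r.
- rewrite rmorphD /= mderivD IHp IHq -big_split /=.
  by apply: eq_bigr => i _; rewrite mderivD rmorphD mulrDl.
- rewrite rmorphM /= mderivM IHp IHq mulr_suml mulr_sumr -big_split /=.
  apply: eq_bigr => i _; rewrite mderivM rmorphD !rmorphM /= mulrDl mulrAC.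
  by rewrite mulrA.
Qed.

Definition snoc n (T : Type) (g : 'I_n -> T) (h : T) (i : 'I_n.+1) : T :=
  if unlift ord_max i is Some j then g j else h.

Lemma snoc_widen n T (g : 'I_n -> T) h j :
  snoc g h (widen_ord (leqnSn n) j) = g j.
Proof.
rewrite /snoc; have -> : widen_ord (leqnSn n) j = lift ord_max j.
  by apply: val_inj; rewrite /= /bump leqNgt ltn_ord.
by rewrite liftK.
Qed.

Lemma snoc_max n T (g : 'I_n -> T) h : snoc g h ord_max = h.
Proof. by rewrite /snoc unlift_none. Qed.

Lemma msubst_mwiden n N (g : 'I_n -> {mpoly R[N]}) h p :
  msubst (snoc g h) (mwiden p) = msubst g p.
Proof.
elim/mpoly_ring_ind: p => [c|i|p q IHp IHq|p q IHp IHq].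
- by rewrite mwidenC !msubstC.
- by rewrite mwidenX mnmwiden1 !msubstX snoc_widen.
- by rewrite mwidenD !rmorphD /= IHp IHq.
- by rewrite mwidenM !rmorphM /= IHp IHq.
Qed.

Lemma meval_mwiden n (p : {mpoly R[n]}) v :
  (mwiden p).@[v] = p.@[fun i => v (widen_ord (leqnSn n) i)].
Proof.
elim/mpoly_ring_ind: p => [c|i|p q IHp IHq|p q IHp IHq].
- by rewrite mwidenC !mevalC.
- by rewrite mwidenX mnmwiden1 !mevalXU.
- by rewrite mwidenD !mevalD IHp IHq.
- by rewrite mwidenM !mevalM IHp IHq.
Qed.

(** Division by the last variable. The independence proofs use it to peel a relation: kill [F0],
    then pass to the smaller [F1]. *)
Lemma mpoly_snoc n (F : {mpoly R[n.+1]}) :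
  exists F0 F1, F = mwiden F0 + F1 * 'X_ord_max.
Proof.
elim/mpoly_ring_ind: F => [c|i|p q [p0 [p1 ->]] [q0 [q1 ->]]
                         |p q [p0 [p1 ->]] [q0 [q1 ->]]].
- by exists c%:MP, 0; rewrite mwidenC mul0r addr0.
- case: (unliftP ord_max i) => [j ->|->].
    exists 'X_j, 0; rewrite mwidenX mnmwiden1 mul0r addr0; congr 'X__.
    by apply: val_inj; rewrite /= /bump leqNgt ltn_ord.
  by exists 0, 1; rewrite mwiden0 add0r mul1r.
- exists (p0 + q0), (p1 + q1); rewrite mwidenD mulrDl.
  by rewrite addrACA.
- exists (p0 * q0), (mwiden p0 * q1 + p1 * mwiden q0 + p1 * q1 * 'X_ord_max).
  rewrite mwidenM mulrDl !mulrDr -addrA; congr (_ + _).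
  rewrite !mulrDl !mulrA -!addrA; congr (_ + _).
  congr (_ + _); first by rewrite mulrAC.
  by congr (_ * _); rewrite mulrAC.
Qed.

Lemma euler_mpoly n e (p : {mpoly R[n]}) : p \is e.-homog ->
  \sum_i 'X_i * p^`M(i) = p *+ e.
Proof.
move=> hp; rewrite [in RHS](mpolyE p) [in LHS](mpolyE p) -sumrMnl.
under eq_bigr => i _ do rewrite raddf_sum mulr_sumr.
rewrite exchange_big /= big_seq [RHS]big_seq.
apply: eq_bigr => m /(dhomog_mf hp) /= <-.
under eq_bigr => i _.
  rewrite mderivZ mderivX scalerA -scalerAr -mpolyXD.
  have -> : p@_m * (m i)%:R *: 'X_[R, U_(i) + (m - U_(i))] =
            (p@_m *: 'X_[R, m]) *+ m i.
    (* Subtraction of exponents is truncated, so an exponent [m i = 0] is treated apart; its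
       coefficient is zero. *)
    case: (posnP (m i)) => [->|mi]; first by rewrite mulr0 scale0r mulr0n.
    rewrite addmC submK ?lep1mP -?lt0n //.
    by rewrite mulr_natr scalerMnl.
  over.
by rewrite sumrMnr mdegE.
Qed.

Lemma dhomog_mderiv n e (p : {mpoly R[n]}) i :
  p \is e.-homog -> p^`M(i) \is (e.-1).-homog.
Proof.
move=> hp; apply/dhomogP => m; rewrite mcoeff_msupp mcoeff_deriv => nz.
have : (m + U_(i))%MM \in msupp p.
  by rewrite mcoeff_msupp; apply: contraNneq nz => ->; rewrite mul0rn.
by move/(dhomog_mf hp) => /=; rewrite mdegD mdeg1 addn1 => <-.
Qed.

Lemma meval_dhomog n e (p : {mpoly R[n]}) c v : p \is e.-homog ->
  p.@[fun i => c * v i] = c ^+ e * p.@[v].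
Proof.
move=> hp; rewrite !mevalE mulr_sumr big_seq [RHS]big_seq.
apply: eq_bigr => m /(dhomog_mf hp) /= <-.
rewrite mulrCA; congr (_ * _).
under eq_bigr => i _ do rewrite exprMn.
by rewrite big_split /= prodrXr -mdegE.
Qed.

Lemma dhomog_msubst n N (g : 'I_n -> {mpoly R[N]}) d b F :
    F \is d.-homog -> (forall i, g i \is b.-homog) ->
  msubst g F \is (b * d).-homog.
Proof.
move=> hF hg; rewrite /msubst /mmap big_seq; apply: rpred_sum => m mF.
rewrite mul_mpolyC; apply: rpredZ.
have /= <- := dhomog_mf hF mF.
rewrite mdegE /mmap1; elim/big_rec2: _ => [|i p e _ hp].
  by rewrite muln0; apply: dhomog1.
by rewrite mulnDr; apply: dhomogM => //; apply: dhomogMn.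
Qed.

Lemma dhomog_Xexp n (a : 'I_n) e : ('X_a ^+ e : {mpoly R[n]}) \is e.-homog.
Proof.
have X1 : ('X_a : {mpoly R[n]}) \is 1.-homog by rewrite dhomogX /= mdeg1.
by have := dhomogMn e X1; rewrite mul1n.
Qed.

Lemma mpoly_line n (p : {mpoly R[n]}) u v :
  exists q : {poly R}, forall t, q.[t] = p.@[fun i => u i + t * v i].
Proof.
elim/mpoly_ring_ind: p => [c|i|p1 p2 [q1 E1] [q2 E2]|p1 p2 [q1 E1] [q2 E2]].
- by exists c%:P => t; rewrite hornerC mevalC.
- exists ((u i)%:P + 'X * (v i)%:P) => t; rewrite mevalXU.
  by rewrite hornerD hornerC hornerM hornerC hornerX.
- by exists (q1 + q2) => t; rewrite hornerD mevalD E1 E2.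
- by exists (q1 * q2) => t; rewrite hornerM mevalM E1 E2.
Qed.

End MPolyFacts.

(** * Algebraic dependence and the Jacobian criterion *)

Section CharZero.
Variable k : fieldType.
Hypothesis char0 : [pchar k] =i pred0.

Lemma natr_neq0 n : (n.+1%:R : k) != 0.
Proof. by rewrite (pcharf0P _).1. Qed.

(** In characteristic 0 the naturals below [size q] are distinct in [k], and they are too many to be
    all roots. *)
Lemma poly_nonroot (q : {poly k}) : q != 0 -> exists t, q.[t] != 0.
Proof.
move=> nz; apply: NNPP => nE.
have allr : all (root q) [seq i%:R | i <- iota 0 (size q)].
  apply/allP => t _; apply: contraT => nr; case: nE.
  by exists t; rewrite -rootE.
have := max_poly_roots nz allr; rewrite size_map size_iota ltnn => /(_ _) H.
suff /H : uniq [seq (i%:R : k) | i <- iota 0 (size q)] by [].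
rewrite map_inj_uniq ?iota_uniq // => a b /eqP.
wlog le : a b / (a <= b)%N.
  by move=> W; case/orP: (leq_total a b) => /W // + E; rewrite eq_sym in E => /(_ E).
rewrite eq_sym -subr_eq0 -natrB // (pcharf0P _).1 // subn_eq0 => le'.
by apply/eqP; rewrite eqn_leq le le'.
Qed.

Lemma mpoly_nonroot n (p : {mpoly k[n]}) : p != 0 -> exists v, p.@[v] != 0.
Proof.
elim: n p => [|n IH] p nz.
  exists (fun _ => 0); rewrite (nvar0_mpolyC p) mevalC.
  by apply: contraNneq nz => E; rewrite (nvar0_mpolyC p) E mpolyC0.
(* The strengthening to a non-zero last coordinate lets a factor [X_ord_max] be divided out when
   [p0 = 0]. *)
suff [v []] : exists v, p.@[v] != 0 /\ v ord_max != 0 by exists v.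
have [m] := ubnP (msize p); elim: m p nz => // m IHm p nz lt.
have [p0 [p1 E]] := mpoly_snoc p.
have [p0z|p0nz] := eqVneq p0 0.
  move: E; rewrite p0z mwiden0 add0r => E.
  have p1nz : p1 != 0 by apply: contraNneq nz => z; rewrite E z mul0r.
  have Xnz : 'X_ord_max != 0 :> {mpoly k[n.+1]}.
    by rewrite -msize_poly_eq0 msizeX.
  have [|v [v1 v2]] := IHm p1 p1nz.
    move: lt; rewrite E (msizeM p1nz Xnz) msizeX mdeg1 addn2 /=.
    by rewrite ltnS.
  by exists v; rewrite E mevalM mevalXU mulf_neq0.
have [v vP] := IH _ p0nz.
have [q qE] := mpoly_line p (snoc v 0) (snoc (fun=> 0) 1).
have q0 : q.[0] != 0.
  rewrite qE E mevalD meval_mwiden mevalM mevalXU /= !snoc_max mulr1 addr0 mulr0.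
  rewrite addr0; apply: contraNneq vP => <-; apply/eqP.
  by apply: meval_eq => i; rewrite !snoc_widen mul0r addr0.
have [|t] := @poly_nonroot (q * 'X).
  by rewrite mulf_neq0 ?polyX_eq0 //; apply: contraNneq q0 => ->; rewrite horner0.
rewrite hornerM hornerX mulf_eq0 negb_or qE => /andP[h1 h2].
eexists; split; first exact: h1.
by rewrite /= !snoc_max mulr1 add0r.
Qed.

Lemma mpoly_eq0P n (p : {mpoly k[n]}) : (forall v, p.@[v] = 0) -> p = 0.
Proof.
move=> H; apply/eqP; apply: contraT => /mpoly_nonroot[v].
by rewrite H eqxx.
Qed.

(** A line is irreducible: the restrictions of [p] and [q] are univariate, and if both were non-zero
    so would be their product somewhere. *)
Lemma line_irreducible n (p q : {mpoly k[n]}) u v t0 :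
    p.@[fun i => u i + t0 * v i] != 0 ->
    (forall t, p.@[fun i => u i + t * v i] != 0 ->
       q.@[fun i => u i + t * v i] = 0) ->
  forall t, q.@[fun i => u i + t * v i] = 0.
Proof.
have [P PE] := mpoly_line p u v; have [Q QE] := mpoly_line q u v.
rewrite -PE => nz H t; rewrite -QE.
suff -> : Q = 0 by rewrite horner0.
apply/eqP; apply: contraT => Qnz.
have Pnz : P != 0 by apply: contraNneq nz => ->; rewrite horner0.
have [t'] := poly_nonroot (mulf_neq0 Pnz Qnz).
rewrite hornerM mulf_eq0 negb_or PE => /andP[/H]; rewrite QE => ->.
by rewrite eqxx.
Qed.

Lemma msize_mderiv n (p : {mpoly k[n]}) i :
  p^`M(i) != 0 -> (msize p^`M(i) < msize p)%N.
Proof.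
move=> nz; have := mlead_supp nz.
rewrite mcoeff_msupp mcoeff_deriv => nz'.
have : (mlead p^`M(i) + U_(i))%MM \in msupp p.
  by rewrite mcoeff_msupp; apply: contraNneq nz' => ->; rewrite mul0rn.
by move/msize_mdeg_lt; rewrite mdegD mdeg1 addn1 mlead_deg.
Qed.

Lemma mderiv_eq0 n (p : {mpoly k[n]}) i (m : 'X_{1..n}) :
  p^`M(i) = 0 -> m i != 0%N -> p@_m = 0.
Proof.
move=> d0 mi; have := mcoeff_deriv i (m - U_(i))%MM p.
rewrite d0 mcoeff0 submK ?lep1mP // -mulr_natr => /esym/eqP.
by rewrite mulf_eq0 (negPf (natr_neq0 _)) orbF => /eqP.
Qed.

Definition algdep n N (g : 'I_n -> {mpoly k[N]}) : Prop :=
  exists F : {mpoly k[n]}, F != 0 /\ msubst g F = 0.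

(** As long as a non-zero partial derivative of the relation is again a relation, it replaces it and
    has smaller size. At the end the chain rule yields a non-trivial linear relation between
    differentials. *)
Lemma algdep_minimal n N (g : 'I_n -> {mpoly k[N]}) : algdep g ->
  exists F : {mpoly k[n]}, [/\ F != 0, msubst g F = 0
    & forall i, F^`M(i) != 0 -> msubst g F^`M(i) != 0].
Proof.
case=> F [nz z]; have [m] := ubnP (msize F).
elim: m F nz z => // m IHm F nz z lt.
case: (classic (exists i, F^`M(i) != 0 /\ msubst g F^`M(i) = 0)).
  case=> i [nzi zi]; apply: (IHm F^`M(i)) => //.
  by apply: leq_trans (msize_mderiv nzi) _.
move=> H; exists F; split=> // i nzi; apply/negP => /eqP zi.
by case: H; exists i.
Qed.

Lemma relation_nonconst n N (g : 'I_n -> {mpoly k[N]}) F :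
  F != 0 -> msubst g F = 0 -> exists i, F^`M(i) != 0.
Proof.
move=> nz z; apply: NNPP => H.
have d0 i : F^`M(i) = 0.
  by apply/eqP; apply: contraT => nzi; case: H; exists i.
have E : F = (F@_0)%:MP.
  apply/mpolyP => m; rewrite mcoeffC.
  have [->|mz] := eqVneq m 0%MM; first by rewrite mulr1.
  rewrite mulr0; have [i mi] : exists i, m i != 0%N.
    apply: NNPP => Hm; move/eqP: mz; apply; apply/mnmP => i.
    by rewrite mnm0E; apply/eqP; apply: contraT => mi; case: Hm; exists i.
  exact: mderiv_eq0 (d0 i) mi.
move: z nz; rewrite E msubstC => /eqP; rewrite mpolyC_eq0 => /eqP ->.
by rewrite mpolyC0 eqxx.
Qed.

Definition jac n N (g : 'I_n -> {mpoly k[N]}) (v : 'I_N -> k) : 'M[k]_(n, N) :=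
  \matrix_(i, j) (g i)^`M(j).@[v].

(** The chain rule turns a minimal relation into a non-zero row killing the Jacobian over the
    polynomial ring. A right inverse at [v] makes a square product with non-zero determinant, and
    its adjugate then kills that row. *)
Lemma jac_row_free n N (g : 'I_n -> {mpoly k[N]}) v :
  row_free (jac g v) -> ~ algdep g.
Proof.
case/row_freeP => V JV /algdep_minimal[F [nz z Fmin]].
have [i0 /Fmin wnz] := relation_nonconst nz z.
pose J : 'M[{mpoly k[N]}]_(n, N) := \matrix_(i, j) (g i)^`M(j).
pose w : 'rV[{mpoly k[N]}]_n := \row_i msubst g F^`M(i).
have wJ : w *m J = 0.
  apply/rowP => j; rewrite !mxE.
  have := congr1 (mderiv j) z; rewrite mderiv0 mderiv_msubst; apply: etrans.
  by apply: eq_bigr => i _; rewrite !mxE.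
pose K := J *m map_mx (@mpolyC N k) V.
have detK : \det K != 0.
  suff : (\det K).@[v] != 0 by apply: contraNneq => ->; rewrite meval0.
  have -> : (\det K).@[v] = \det (map_mx (meval v) K) by rewrite -det_map_mx.
  rewrite map_mxM /= -map_mx_comp.
  have -> : map_mx (meval v \o @mpolyC N k) V = V.
    by apply/matrixP => i j; rewrite !mxE /= mevalC.
  have -> : map_mx (meval v) J = jac g v by apply/matrixP => i j; rewrite !mxE.
  by rewrite JV det1 oner_neq0.
have : w *m K *m \adj K = 0 by rewrite mulmxA wJ !mul0mx.
rewrite -mulmxA mul_mx_adj mul_mx_scalar => /matrixP/(_ 0 i0).
rewrite !mxE => /eqP; rewrite mulf_eq0 (negPf detK) /= => /eqP E.
by move/eqP: wnz.
Qed.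

End CharZero.

Lemma msize_prod_le (k : fieldType) N n (F : 'I_n -> {mpoly k[N]}) (d : nat) :
  (forall i, msize (F i) <= d.+1)%N -> (msize (\prod_i F i) <= (n * d).+1)%N.
Proof.
move=> H; elim: n F H => [|n IH] F H; first by rewrite big_ord0 msize1.
rewrite big_ord_recl; set P := \prod_i _.
have [->|nzF] := eqVneq (F ord0) 0; first by rewrite mul0r mmeasure0.
have [->|nzP] := eqVneq P 0; first by rewrite mulr0 mmeasure0.
rewrite msizeM // /P.
have := leq_add (H ord0) (IH (fun i => F (lift ord0 i)) (fun i => H _)).
by move/(leq_sub2r 1); rewrite !subn1 mulSn addSn addnS.
Qed.

Lemma msize_exp_le (k : fieldType) N (F : {mpoly k[N]}) (d e : nat) :
  (msize F <= d.+1)%N -> (msize (F ^+ e) <= (e * d).+1)%N.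
Proof.
move=> H; rewrite -[e in F ^+ e]card_ord -prodr_const.
by apply: msize_prod_le => i; apply: H.
Qed.

(* Compare the [D ^ n] monomials with exponents below [D] with the at most
   [(n D d + 1) ^ N] monomials occurring in their images. *)
Lemma algdep_overfull (k : fieldType) n N (g : 'I_n -> {mpoly k[N]}) :
  (N < n)%N -> algdep g.
Proof.
move=> ltNn.
pose d := \max_i msize (g i).
have sg i : (msize (g i) <= d.+1)%N by apply/leqW/(leq_bigmax i).
(* The bounds give [K <= D * C], hence [K ^ N <= D ^ N * C ^ N < D ^ N.+1 <= D ^ n]. *)
pose C := (n * d).+1; pose D := (C ^ N).+1; pose K := (n * (D * d)).+1.
have leK : (K <= D * C)%N by rewrite /K /C; have : (0 < D)%N by []; nia.
pose I := {ffun 'I_n -> 'I_D}; pose J := {ffun 'I_N -> 'I_K}.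
have cJI : (#|J| < #|I|)%N.
  rewrite /I /J !card_ffun !card_ord.
  apply: (@leq_ltn_trans ((D * C) ^ N)); first by case: (N) => // ?; rewrite leq_exp2r.
  rewrite expnMn; apply: (@leq_trans (D ^ N.+1)); last by rewrite leq_pexp2l.
  by rewrite expnSr ltn_pmul2l ?expn_gt0 // /D ltnS.
pose mI (f : I) : 'X_{1..n} := [multinom (f i : nat) | i < n].
pose mJ (f : J) : 'X_{1..N} := [multinom (f i : nat) | i < N].
pose A : 'M[k]_(#|I|, #|J|) :=
  \matrix_(a, b) (msubst g 'X_[mI (enum_val a)])@_(mJ (enum_val b)).
have : kermx A != 0.
  rewrite kermx_eq0 /row_free; have := rank_leq_col A.
  by apply: contraTneq => ->; rewrite -ltnNge.
case/rowV0Pn => u /sub_kermxP uA unz.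
pose F := \sum_a u 0 a *: 'X_[k, mI (enum_val a)].
have inj_mI : injective mI.
  move=> f h /mnmP E; apply/ffunP => i; apply: val_inj.
  by have := E i; rewrite !mnmE.
exists F; split.
  have [a ua] : exists a, u 0 a != 0.
    apply: NNPP => H; move/eqP: unz; apply; apply/rowP => a; rewrite mxE.
    by apply/eqP; apply: contraT => ua; case: H; exists a.
  apply: contraNneq ua => F0.
  have := congr1 (mcoeff (mI (enum_val a))) F0.
  rewrite mcoeff0 raddf_sum (bigD1 a) //= mcoeffZ mcoeffX eqxx mulr1.
  rewrite big1 ?addr0 => [->//|b ne].
  rewrite mcoeffZ mcoeffX (inj_eq inj_mI) (inj_eq enum_val_inj) (negPf ne).
  by rewrite mulr0.
apply/mpolyP => m; rewrite mcoeff0 /F (raddf_sum (msubst g)) (raddf_sum (mcoeff m)) /=.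
case: (classic (forall i, (m i < K)%N)) => [mK|nmK].
  pose b := enum_rank ([ffun i => Ordinal (mK i)] : J).
  have -> : m = mJ (enum_val b).
    by apply/mnmP => i; rewrite mnmE enum_rankK ffunE.
  move/matrixP/(_ 0 b): uA; rewrite !mxE => E; apply: etrans E.
  by apply: eq_bigr => a _; rewrite mxE msubstZ mcoeffZ.
rewrite big1 // => a _; rewrite msubstZ mcoeffZ memN_msupp_eq0 ?mulr0 //.
apply: msize_mdeg_ge; rewrite leqNgt; apply/negP => lt; apply: nmK => i.
have lei : (m i <= mdeg m)%N by rewrite mdegE (bigD1 i) //= leq_addr.
apply: leq_ltn_trans lei _; apply: leq_trans lt _.
rewrite /msubst mmapX /mmap1; apply: msize_prod_le => j; rewrite mnmE.
apply: leq_trans (msize_exp_le _ (sg j)) _.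
by rewrite ltnS leq_mul2r ltnW ?orbT.
Qed.

Section CharZero.
Variable k : fieldType.
Hypothesis char0 : [pchar k] =i pred0.

Lemma mwiden_mderiv0 n (F : {mpoly k[n.+1]}) :
  F^`M(ord_max) = 0 -> exists F0, F = mwiden F0.
Proof.
move=> d0; have [F0 [F1 E]] := mpoly_snoc F; exists F0; rewrite E.
suff -> : F1 = 0 by rewrite mul0r addr0.
apply/mpolyP => m; rewrite mcoeff0 -(mcoeffMX F1 U_(ord_max) m).
have -> : F1 * 'X_ord_max = F - mwiden F0 by rewrite E addrAC subrr add0r.
rewrite mcoeffB (mderiv_eq0 char0 d0) ?sub0r; last first.
  by rewrite mnmDE mnm1E eqxx.
apply/eqP; rewrite oppr_eq0; apply/eqP.
apply: (@mderiv_eq0 _ char0 _ _ ord_max); last by rewrite mnmDE mnm1E eqxx.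
elim/mpoly_ring_ind: F0 {E} => [c|i|p q IHp IHq|p q IHp IHq].
- by rewrite mwidenC mderivC.
- by rewrite mwidenX mnmwiden1 mderivXU -val_eqE /= ltn_eqF ?ltn_ord.
- by rewrite mwidenD mderivD IHp IHq addr0.
- by rewrite mwidenM mderivM IHp IHq mul0r mulr0 addr0.
Qed.

Lemma jac_snoc n N (g : 'I_n -> {mpoly k[N]}) h v :
  row_free (jac (snoc g h) v) -> row_free (jac g v).
Proof.
move=> /row_freeP[V E]; apply/row_freeP.
exists (\matrix_(i, j) V i (widen_ord (leqnSn n) j)).
apply/matrixP => i j.
have /matrixP/(_ (widen_ord (leqnSn n) i) (widen_ord (leqnSn n) j)) := E.
rewrite !mxE -val_eqE /= => <-; apply: eq_bigr => l _.
by rewrite !mxE snoc_widen.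
Qed.

(* Extend [g] by coordinate functions as long as it stays independent; when no
   coordinate can be added, differentiating minimal relations writes each
   coordinate differential as a combination of those of [g]. *)
Lemma jacobian_criterion n N (g : 'I_n -> {mpoly k[N]}) :
  ~ algdep g -> exists v, row_free (jac g v).
Proof.
have [m] := ubnP (N - n); elim: m n g => // m IHm n g lt ind.
have lenN : (n <= N)%N.
  by rewrite leqNgt; apply/negP => /(algdep_overfull g).
case: (classic (exists j, ~ algdep (snoc g 'X_j))) => [[j indj]|H].
  have ltnN : (n < N)%N.
    by rewrite ltnNge; apply/negP => /(algdep_overfull (snoc g 'X_j)).
  have [|v] := IHm _ _ _ indj; first by lia.
  by move/jac_snoc => fr; exists v.
(* The minimal relation must involve its last variable, since otherwise it would already be a
   relation on [g]. *)
have rel j : exists F : {mpoly k[n.+1]}, msubst (snoc g 'X_j) F = 0 /\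
    msubst (snoc g 'X_j) F^`M(ord_max) != 0.
  have : algdep (snoc g 'X_j) by apply: NNPP => nd; apply: H; exists j.
  case/algdep_minimal => F [nz z Fmin]; exists F; split=> //.
  apply: Fmin; apply/negP => /eqP /mwiden_mderiv0[F0 E].
  apply: ind; exists F0; split; last by rewrite -(msubst_mwiden g 'X_j) -E.
  by apply: contraNneq nz => F0z; rewrite E F0z mwiden0.
have [F FP] := fin_all_exists rel.
pose a j := msubst (snoc g 'X_j) (F j)^`M(ord_max).
have : \prod_j a j != 0.
  by apply/prodf_neq0 => j _; case: (FP j).
case/(mpoly_nonroot char0) => v; rewrite rmorph_prod /= => /prodf_neq0 av.
exists v.
pose d : 'rV[k]_N := \row_j (a j).@[v].
pose B : 'M[k]_(N, n) := \matrix_(j, i)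
  (msubst (snoc g 'X_j) (F j)^`M(widen_ord (leqnSn n) i)).@[v].
have dBJ : diag_mx d = - B *m jac g v.
  apply/matrixP => j l; rewrite mulNmx !mxE.
  have := congr1 (fun p => (mderiv l p).@[v]) (FP j).1.
  rewrite /= mderiv0 meval0 mderiv_msubst big_ord_recr /= mevalD.
  rewrite snoc_max mevalM -/(a j) => /eqP; rewrite addrC addr_eq0.
  rewrite mderivXU rmorph_nat mulr_natr.
  move=> /eqP ->; rewrite (raddf_sum (meval v)) /=; congr (- _).
  apply: eq_bigr => i _; rewrite mevalM !mxE snoc_widen //.
have rd : \rank (diag_mx d) = N.
  apply/mxrank_unit; rewrite unitmxE det_diag unitfE.
  by apply/prodf_neq0 => j _; rewrite mxE av.
rewrite /row_free eqn_leq rank_leq_row (leq_trans lenN) //.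
by rewrite -[X in (X <= _)%N]rd dBJ mxrankM_maxr.
Qed.

End CharZero.

(** * Chains of irreducible closed sets *)

Section Projective.
Variable k : closedFieldType.
Hypothesis char0 : [pchar k] =i pred0.

Lemma meval_scale N (p : {mpoly k[N]}) (c : k) (v : 'rV[k]_N) :
  p.@[(c *: v) 0] = p.@[fun i => c * v 0 i].
Proof. by apply: meval_eq => i; rewrite mxE. Qed.

(** On the line through [v], [p] becomes a univariate polynomial in [c] whose coefficients are the
    values at [v] of its homogeneous components. *)
Lemma pihomog_vanish N (p : {mpoly k[N]}) (v : 'I_N -> k) :
    (forall c, c != 0 -> p.@[fun i => c * v i] = 0) ->
  forall e, (pihomog mdeg e p).@[v] = 0.
Proof.
(* The bound also exceeds [e], so that the coefficient of index [e] is in range. *)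
move=> H e; pose K := maxn (msize p) e.+1.
pose q := \poly_(d < K) (pihomog mdeg d p).@[v].
have qE c : q.[c] = p.@[fun i => c * v i].
  rewrite horner_poly [in RHS](@pihomog_partitionE _ _ mdeg K p) ?leq_maxl //.
  rewrite (raddf_sum (meval _)) /=; apply: eq_bigr => d _.
  by rewrite (meval_dhomog _ _ (pihomogP _ d p)) mulrC.
suff q0 : q = 0.
  have := coef_poly K (fun d => (pihomog mdeg d p).@[v]) e.
  by rewrite -/q q0 coef0 leq_maxr.
apply/eqP; apply: contraT => nz.
have [|c] := poly_nonroot char0 (q := q * 'X).
  by rewrite mulf_neq0 ?polyX_eq0.
rewrite hornerM hornerX qE mulf_eq0 negb_or => /andP[+ cnz].
by rewrite H ?eqxx.
Qed.

Definition vanish N (p : {mpoly k[N]}) (X : vset k N) : Prop :=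
  forall v, X v -> p.@[v 0] = 0.

Definition is_cone N (X : vset k N) : Prop :=
  forall v c, c != 0 -> X v -> X (c *: v).

Lemma vanish_components N (p : {mpoly k[N]}) (X : vset k N) : is_cone X ->
  vanish p X <-> forall e, vanish (pihomog mdeg e p) X.
Proof.
move=> coneX; split=> [H e v Xv|H v Xv].
  apply: pihomog_vanish => c cnz; rewrite -meval_scale.
  by apply: H; apply: coneX.
rewrite (@pihomog_partitionE _ _ mdeg (msize p) p) //.
rewrite (raddf_sum (meval _)) big1 // => d _ /=; exact: H.
Qed.

Lemma proj_closed_cone N (X : vset k N) : proj_closed X -> is_cone X.
Proof.
case=> S [hS XE] v c cnz /XE[vnz Sv]; apply/XE; split.
  by rewrite scaler_eq0 negb_or cnz.
move=> p Sp; have [e he] := hS p Sp.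
by rewrite meval_scale (meval_dhomog _ _ he) Sv ?mulr0.
Qed.

Lemma proj_closure_closed N (A : vset k N) : proj_closed (proj_closure A).
Proof.
exists (fun p => (exists e, p \is e.-homog) /\ vanish p A); split.
  by move=> p [].
move=> v; split=> -[vnz H]; split=> //.
  by move=> p [[e he] pA]; apply: (H e p he).
by move=> e p he pA; apply: H; split=> //; exists e.
Qed.

(** The closure only tests forms; over a cone an arbitrary polynomial may be tested component by
    component. *)
Lemma vanish_closure N (p : {mpoly k[N]}) (A : vset k N) :
  is_cone A -> vanish p A -> vanish p (proj_closure A).
Proof.
move=> coneA pA; apply/vanish_components.
  exact: proj_closed_cone (@proj_closure_closed _ _).
move=> e v [_]; apply; first exact: pihomogP.
by move: e; apply/vanish_components.
Qed.

Lemma vincl_closure N (A B : vset k N) :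
  vincl A B -> vincl (proj_closure A) (proj_closure B).
Proof.
move=> sAB v [vnz H]; split=> // e p he pB; apply: (H e p he) => a Aa.
exact/pB/sAB.
Qed.

Lemma vincl_proj_closure N (A : vset k N) :
  (forall a, A a -> a != 0) -> vincl A (proj_closure A).
Proof. by move=> A0 v Av; split; [exact: A0 | move=> e p _; apply]. Qed.

(** X is covered by two closed sets. As [h] need not be homogeneous, its zero set is replaced by the
    common zeros of its components; a point off [g = 0] lies there because X is a cone. *)
Lemma irreducible_prime N (X : vset k N) e (g h : {mpoly k[N]}) :
    proj_irreducible_closed X -> g \is e.-homog -> vanish (g * h) X ->
  vanish g X \/ vanish h X.
Proof.
case=> clX _ irrX hg ghX.
have coneX := proj_closed_cone clX.
have nzX v : X v -> v != 0 by case: clX => S [_ XE] /XE[].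
pose B : vset k N := fun v => v != 0 /\ g.@[v 0] = 0.
pose C : vset k N := fun v => v != 0 /\ forall d, (pihomog mdeg d h).@[v 0] = 0.
have clB : proj_closed B.
  exists (fun p => p = g); split=> [p ->|v]; first by exists e.
  split=> -[vnz H]; split=> //; first by move=> p ->.
  exact: H.
have clC : proj_closed C.
  exists (fun p => exists d, p = pihomog mdeg d h); split=> [p [d ->]|v].
    by exists d; apply: pihomogP.
  split=> -[vnz H]; split=> //; first by move=> p [d ->].
  by move=> d; apply: H; exists d.
have cov v : X v -> B v \/ C v.
  move=> Xv; have [gv|gv] := eqVneq g.@[v 0] 0.
    by left; split=> //; apply: nzX.
  right; split; first exact: nzX.
  apply: pihomog_vanish => c cnz.
  have := ghX _ (coneX v c cnz Xv).
  rewrite mevalM !meval_scale (meval_dhomog _ _ hg) => /eqP.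
  by rewrite !mulf_eq0 expf_eq0 (negPf cnz) (negPf gv) andbF /= => /eqP.
case: (irrX B C clB clC cov) => sX; [left | right].
  by move=> v /sX[].
apply/vanish_components => // d v /sX[_]; exact.
Qed.

Definition indep_on n N (g : 'I_n -> {mpoly k[N]}) (X : vset k N) : Prop :=
  forall F : {mpoly k[n]}, vanish (msubst g F) X -> F = 0.

(** A cone contains the punctured line through [v], on which a coordinate non-zero at [v] takes
    every non-zero value. *)
Lemma indep_on_point N (X : vset k N) v : is_cone X -> X v -> v != 0 ->
  exists g : 'I_1 -> {mpoly k[N]}, indep_on g X.
Proof.
move=> coneX Xv /rV0Pn[j vj]; exists (fun=> 'X_j) => F F0.
apply/eqP; apply: contraT => Fnz.
have Xnz : 'X_ord0 != 0 :> {mpoly k[1]} by rewrite -msize_poly_eq0 msizeX.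
have [t] := mpoly_nonroot char0 (mulf_neq0 Fnz Xnz).
rewrite mevalM mevalXU mulf_eq0 negb_or => /andP[Ft tnz].
have cnz : t ord0 / v 0 j != 0 by rewrite mulf_neq0 ?invr_eq0.
rewrite -(negPf Ft) -(F0 _ (coneX v _ cnz Xv)) meval_msubst; apply/eqP.
by apply: meval_eq => i; rewrite mevalXU mxE divfK // ord1.
Qed.

(** On X the last variable of a relation becomes 0, so its part free of that variable vanishes. What
    remains is divisible by [h] on Y, and irreducibility cancels [h]; iterate on the size. *)
Lemma indep_on_snoc N n (g : 'I_n -> {mpoly k[N]}) (X Y : vset k N) e h :
    indep_on g X -> vincl X Y -> proj_irreducible_closed Y ->
    h \is e.-homog -> vanish h X -> ~ vanish h Y ->
  indep_on (snoc g h) Y.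
Proof.
move=> indg sXY irrY hh hX hY F.
have [m] := ubnP (msize F); elim: m F => // m IHm F lt FY.
have [F0 [F1 E]] := mpoly_snoc F.
have F00 : F0 = 0.
  apply: indg => v Xv; have := FY _ (sXY _ Xv).
  rewrite E rmorphD rmorphM /= msubst_mwiden msubstX snoc_max mevalD mevalM.
  by rewrite (hX _ Xv) mulr0 addr0.
move: E; rewrite F00 mwiden0 add0r => E.
have [F10|F1nz] := eqVneq F1 0; first by rewrite E F10 mul0r.
have Xnz : 'X_ord_max != 0 :> {mpoly k[n.+1]}.
  by rewrite -msize_poly_eq0 msizeX.
suff F10 : F1 = 0 by rewrite E F10 mul0r.
apply: IHm.
  by move: lt; rewrite E (msizeM F1nz Xnz) msizeX mdeg1 addn2.
have FY' : vanish (h * msubst (snoc g h) F1) Y.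
  by move=> v /FY; rewrite E rmorphM /= msubstX snoc_max mulrC.
by case: (irreducible_prime irrY hh FY').
Qed.

Lemma separating_form N (X Y : vset k N) : proj_closed X -> ~ vincl Y X ->
    (forall v, Y v -> v != 0) ->
  exists e h, [/\ h \is e.-homog, vanish h X & ~ vanish h Y].
Proof.
case=> S [hS XE] nYX nzY.
have [v [Yv nXv]] : exists v, Y v /\ ~ X v.
  apply: NNPP => H; apply: nYX => v Yv; apply: NNPP => nXv.
  by apply: H; exists v.
have [p [Sp pv]] : exists p, S p /\ p.@[v 0] <> 0.
  apply: NNPP => H; apply: nXv; apply/XE; split; first exact: nzY.
  by move=> p Sp; apply: NNPP => pv; apply: H; exists p.
have [e he] := hS p Sp; exists e, p; split=> //.
  by move=> w /XE[_]; apply.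
by move=> H; apply/pv/H.
Qed.

Lemma irreducible_nz N (X : vset k N) v :
  proj_irreducible_closed X -> X v -> v != 0.
Proof. by case=> -[S [_ XE]] _ _ /XE[]. Qed.

(* Forms [g_i] vanishing on [X_(i-1)] but not on [X_i], together with a
   coordinate not vanishing at a point of [X_0], are algebraically independent
   on the last member of the chain. *)
Lemma chain_indep N (X : nat -> vset k N) l :
    (forall i, (i <= l)%N -> proj_irreducible_closed (X i)) ->
    (forall i, (i < l)%N -> vincl (X i) (X i.+1) /\ ~ vincl (X i.+1) (X i)) ->
  exists g : 'I_l.+1 -> {mpoly k[N]}, indep_on g (X l).
Proof.
elim: l => [|l IH] irrX incX.
  have irr := irrX 0%N (leqnn _); case: (irr) => clX [v Xv] _.
  apply: (indep_on_point (proj_closed_cone clX) Xv).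
  exact: irreducible_nz irr Xv.
have [||g indg] := IH; first by move=> i le; apply: irrX; apply: leqW.
  by move=> i lt; apply: incX; apply: leqW.
have irrl := irrX l (leqnSn l); have irrS := irrX l.+1 (leqnn _).
have [s ns] := incX l (ltnSn l).
have clX : proj_closed (X l) by case: irrl.
have [|e [h [hh hX hY]]] := separating_form clX ns.
  by move=> v; apply: irreducible_nz irrS.
by exists (snoc g h); apply: indep_on_snoc indg s irrS hh hX hY.
Qed.

Lemma irreducible_chain_indep N (A : vset k N) l :
    irreducible_chain (proj_closure A) l -> is_cone A ->
  exists g : 'I_l.+1 -> {mpoly k[N]}, indep_on g A.
Proof.
case=> X [irrX incX] coneA.
have [g indg] := chain_indep (fun i le => (irrX i le).1) incX.
exists g => F FA; apply: indg => v /(irrX l (leqnn l)).2.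
by apply: vanish_closure.
Qed.

Lemma chain_le_param N N' (A : vset k N) (psi : 'I_N -> {mpoly k[N']}) l :
    is_cone A -> (forall a, A a -> exists x, a = \row_i (psi i).@[x]) ->
  irreducible_chain (proj_closure A) l -> (l < N')%N.
Proof.
move=> coneA AE /irreducible_chain_indep/(_ coneA)[g indg].
rewrite ltnNge; apply/negP => le.
have [F [/eqP Fnz Fz]] := algdep_overfull (fun i => msubst psi (g i)) le.
apply: Fnz; apply: indg => a /AE[x ->].
have := congr1 (meval x) Fz; rewrite meval0 !meval_msubst => E.
apply: etrans E; apply: meval_eq => i; rewrite meval_msubst.
by apply: meval_eq => j; rewrite mxE.
Qed.

(** Adjoining [G] to l + 1 functions independent on A would still give an independent family:
    restricting a relation to A kills its part free of [G], and [G] can then be cancelled in the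
    polynomial ring. *)
Lemma chain_le_hypersurface N (A : vset k N) (G : {mpoly k[N]}) l :
    is_cone A -> G != 0 -> vanish G A ->
  irreducible_chain (proj_closure A) l -> (l.+1 < N)%N.
Proof.
move=> coneA Gnz GA /irreducible_chain_indep/(_ coneA)[g indg].
rewrite ltnNge; apply/negP => le.
have [F []] := algdep_overfull (snoc g G) (le : (N < l.+2)%N).
have [m] := ubnP (msize F); elim: m F => // m IHm F lt Fnz Fz.
have [F0 [F1 E]] := mpoly_snoc F.
have F00 : F0 = 0.
  apply: indg => v Av; have := congr1 (meval (v 0)) Fz.
  rewrite E rmorphD rmorphM /= msubst_mwiden msubstX snoc_max mevalD mevalM.
  by rewrite (GA _ Av) mulr0 addr0 meval0.
move: E; rewrite F00 mwiden0 add0r => E.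
have F1nz : F1 != 0 by apply: contraNneq Fnz => z; rewrite E z mul0r.
have Xnz : 'X_ord_max != 0 :> {mpoly k[l.+2]}.
  by rewrite -msize_poly_eq0 msizeX.
apply: (IHm F1) => //.
  by move: lt; rewrite E (msizeM F1nz Xnz) msizeX mdeg1 addn2.
move: Fz; rewrite E rmorphM /= msubstX snoc_max => /eqP.
by rewrite mulf_eq0 (negPf Gnz) orbF => /eqP.
Qed.

End Projective.

(** * Closures of images of polynomial maps *)

Section Parametrized.
Variable k : closedFieldType.
Hypothesis char0 : [pchar k] =i pred0.

Lemma meval_row N N' (psi : 'I_N -> {mpoly k[N']}) x p :
  p.@[(\row_i (psi i).@[x]) 0] = (msubst psi p).@[x].
Proof. by rewrite meval_msubst; apply: meval_eq => i; rewrite mxE. Qed.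

(** Image points are required to lie in A only off the hypersurface [u = 0], and points of A need to
    be reached only up to a scalar. This suffices to test forms on A by pulling them back. *)
Definition parametrizes N N' (A : vset k N) (psi : 'I_N -> {mpoly k[N']}) : Prop :=
  (exists2 u : {mpoly k[N']}, u != 0 &
     forall x, u.@[x] != 0 -> A (\row_i (psi i).@[x])) /\
  (forall a, A a -> a != 0 /\ exists c x, a = c *: \row_i (psi i).@[x]).

Lemma vanish_param N N' (A : vset k N) (psi : 'I_N -> {mpoly k[N']}) e h :
  parametrizes A psi -> h \is e.-homog -> vanish h A <-> msubst psi h = 0.
Proof.
case=> -[u unz uA] AE hh; split=> [hA|h0 a /AE[_ [c [x ->]]]].
  apply/eqP; apply: contraT => nz.
  have [x] := mpoly_nonroot char0 (mulf_neq0 unz nz).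
  rewrite mevalM mulf_eq0 negb_or => /andP[/uA/hA].
  by rewrite meval_row => ->; rewrite eqxx.
by rewrite meval_scale (meval_dhomog _ _ hh) meval_row h0 meval0 mulr0.
Qed.

(** If neither closed set contained the closure, forms separating them would pull back to non-zero
    polynomials, whose product with [u] is non-zero at some parameter; its image lies in neither
    set. *)
Lemma irreducible_param N N' (A : vset k N) (psi : 'I_N -> {mpoly k[N']}) :
  parametrizes A psi -> proj_irreducible_closed (proj_closure A).
Proof.
move=> pA; case: (pA) => -[u unz uA] AE; split.
- exact: proj_closure_closed.
- have [x ux] := mpoly_nonroot char0 unz.
  exists (\row_i (psi i).@[x]); apply: vincl_proj_closure; last exact: uA.
  by move=> a /AE[].
move=> B C clB clC cov; apply: NNPP => H.
have [nB nC] : ~ vincl (proj_closure A) B /\ ~ vincl (proj_closure A) C.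
  by split=> ?; apply: H; [left | right].
have nz v : proj_closure A v -> v != 0 by case.
have [e [h [hh hB hA]]] := separating_form clB nB nz.
have [e' [h' [hh' hC hA']]] := separating_form clC nC nz.
have sub_nz d p : p \is d.-homog -> ~ vanish p (proj_closure A) ->
    msubst psi p != 0.
  move=> hp np; apply/negP => /eqP/(vanish_param pA hp) pA'; apply: np.
  by move=> v [_ /(_ _ _ hp)]; apply.
have [x] := mpoly_nonroot char0
  (mulf_neq0 (mulf_neq0 unz (sub_nz _ _ hh hA)) (sub_nz _ _ hh' hA')).
rewrite !mevalM !mulf_eq0 !negb_or -!meval_row => /andP[/andP[/uA Ax hx] h'x].
have Zx : proj_closure A (\row_i (psi i).@[x]).
  by apply: vincl_proj_closure Ax => a /AE[].
case: (cov _ Zx) => [/hB | /hC] E; first by rewrite E eqxx in hx.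
by rewrite E eqxx in h'x.
Qed.

(** If the inclusion were strict, the larger closure could be appended to the chain, exceeding the
    bound [m]. *)
Lemma closure_eq_of_chain N (A B : vset k N) m :
    vincl (proj_closure A) (proj_closure B) ->
    proj_irreducible_closed (proj_closure B) ->
    irreducible_chain (proj_closure A) m ->
    (forall l, irreducible_chain (proj_closure B) l -> (l <= m)%N) ->
  vequal (proj_closure A) (proj_closure B) /\ has_dim (proj_closure A) m.
Proof.
move=> sAB irrB chA boundB; split.
  move=> v; split; first exact: sAB.
  apply: NNPP => nE.
  have nBA : ~ vincl (proj_closure B) (proj_closure A).
    by move=> sBA; apply: nE; apply: sBA.
  have [X [irrX incX]] := chA.
  suff /boundB : irreducible_chain (proj_closure B) m.+1 by rewrite ltnn.
  exists (fun i => if (i <= m)%N then X i else proj_closure B); split=> i.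
    move=> _; case: ifP => [le|_]; last by split.
    split; first by case: (irrX i le).
    by move=> w Xw; apply: sAB; apply: (irrX i le).2.
  rewrite ltnS leq_eqVlt => /orP[/eqP ->|lt].
    rewrite /= eqxx ltnn; split=> [w Xw|sBX].
      by apply: sAB; apply: (irrX m (leqnn m)).2.
    by apply: nBA => w /sBX Xw; apply: (irrX m (leqnn m)).2.
  by rewrite /= lt orbT; apply: incX.
split=> // l [X [irrX incX]]; apply: boundB; exists X; split=> // i le.
by split; [case: (irrX i le) | move=> w Xw; apply/sAB/(irrX i le).2].
Qed.

Lemma closed_exp_root (c : k) n : (0 < n)%N -> exists b, c = b ^+ n.
Proof.
move=> n0; have [b] := @solve_monicpoly k n (fun i => if i == 0%N then c else 0) n0.
case: n n0 => // n _; rewrite big_ord_recl /= expr0 mulr1 big1 ?addr0 => [E|i _].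
  by exists b.
by rewrite mul0r.
Qed.

(** * Images of a flag of linear subspaces under a homogeneous map *)

Section Flag.
Variables (N m delta : nat) (phi : 'I_N -> {mpoly k[m]}).
Hypothesis delta0 : (0 < delta)%N.
Hypothesis phi_homog : forall i, phi i \is delta.-homog.

Definition image_of i (W : 'M[k]_(i, m)) : vset k N := fun y =>
  y != 0 /\ exists z : 'rV[k]_i, y = \row_c (phi c).@[(z *m W) 0].

Definition restrict i (W : 'M[k]_(i, m)) (c : 'I_N) : {mpoly k[i]} :=
  msubst (fun b => \sum_a W a b *: 'X_a) (phi c).

Lemma restrictE i (W : 'M[k]_(i, m)) c x :
  (restrict W c).@[x] = (phi c).@[((\row_a x a) *m W) 0].
Proof.
rewrite meval_msubst; apply: meval_eq => b.
rewrite (raddf_sum (meval x)) !mxE; apply: eq_bigr => a _.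
by rewrite /= mevalZ mevalXU mxE mulrC.
Qed.

Lemma jac_restrict i (W : 'M[k]_(i, m)) x :
  jac (restrict W) x = jac phi (((\row_a x a) *m W) 0) *m W^T.
Proof.
apply/matrixP => c a; rewrite !mxE mderiv_msubst (raddf_sum (meval x)).
apply: eq_bigr => b _; rewrite /= mevalM !mxE; congr (_ * _).
  rewrite meval_msubst; apply: meval_eq => b'.
  rewrite (raddf_sum (meval x)) !mxE; apply: eq_bigr => a' _.
  by rewrite /= mevalZ mevalXU mxE mulrC.
rewrite (raddf_sum (mderiv a)) (raddf_sum (meval x)) (bigD1 a) //=.
rewrite mderivZ mderivXU eqxx mevalZ meval1 mulr1.
rewrite big1 ?addr0 // => a' ne.
by rewrite mderivZ mderivXU (negPf ne) scaler0 meval0.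
Qed.

Lemma image_param i (W : 'M[k]_(i, m)) (z : 'rV_i) :
    (exists c, (phi c).@[(z *m W) 0] != 0) ->
  parametrizes (image_of W) (restrict W).
Proof.
case=> c nz; have zE : z = \row_a z 0 a by apply/rowP => a; rewrite mxE.
split.
  exists (restrict W c).
    suff : (restrict W c).@[z 0] != 0 by apply: contraNneq => ->; rewrite meval0.
    by rewrite restrictE -zE.
  move=> x nzx; split.
    by apply/rV0Pn; exists c; rewrite mxE.
  by exists (\row_a x a); apply/rowP => b; rewrite !mxE restrictE.
move=> a [anz [w E]]; split=> //; exists 1, (w 0); rewrite scale1r E.
apply/rowP => b; rewrite !mxE restrictE; apply: meval_eq => b'.
by congr ((_ *m _) _ _); apply/rowP => a'; rewrite mxE.
Qed.

(* A form vanishing on the image of a space of dimension [i] but not on that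
   of one of dimension [i + 1]: a relation between [i + 1] components of [phi]
   independent on the larger space. *)
Lemma image_separated i (W : 'M[k]_(i, m)) (W' : 'M[k]_(i.+1, m)) (z : 'rV_i.+1) :
    row_free (W' *m (jac phi ((z *m W') 0))^T) ->
    (exists c, (phi c).@[(z *m W') 0] != 0) ->
  ~ vincl (proj_closure (image_of W')) (proj_closure (image_of W)).
Proof.
move=> fr nz sub; have zE : z = \row_a z 0 a by apply/rowP => a; rewrite mxE.
have full : row_full (jac (restrict W') (z 0)).
  rewrite jac_restrict -zE /row_full -mxrank_tr trmx_mul trmxK.
  by rewrite (eqP fr).
pose s := fullrankfun full.
pose theta a := restrict W' (s a).
have ind : ~ algdep theta.
  apply: (@jac_row_free _ char0 _ _ _ (z 0)).
  have -> : jac theta (z 0) = rowsub s (jac (restrict W') (z 0)).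
    by apply/matrixP => a b; rewrite !mxE.
  exact: fullrowsub_free.
have [F [Fnz F0]] := algdep_overfull (fun a => restrict W (s a)) (ltnSn i).
have [e Fe] : exists e, pihomog mdeg e F != 0.
  apply: NNPP => H; move/eqP: Fnz; apply.
  rewrite (@pihomog_partitionE _ _ mdeg (msize F) F) // big1 // => d _.
  by apply/eqP; apply: contraT => nzd; case: H; exists d.
have Fe0 : msubst (fun a => restrict W (s a)) (pihomog mdeg e F) = 0.
  apply: (mpoly_eq0P char0) => x; rewrite meval_msubst.
  apply: (pihomog_vanish char0) => c _.
  (* Scaling the argument by [b] scales every component of [phi] by [b ^+ delta], that is by any
     prescribed [c]; so each homogeneous component of a relation is a relation. *)
  have [b ->] := closed_exp_root c delta0.
  have := congr1 (meval (fun a => b * x a)) F0; rewrite meval0 meval_msubst => E.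
  apply: etrans E; apply: meval_eq => a; rewrite !restrictE.
  rewrite -(meval_dhomog _ _ (phi_homog _)); apply: meval_eq => j.
  have -> : \row_a0 (b * x a0) = b *: \row_a0 x a0.
    by apply/rowP => a0; rewrite !mxE.
  by rewrite -scalemxAl [in RHS]mxE.
pose h := msubst (fun a => 'X_(s a)) (pihomog mdeg e F).
have hh : h \is e.-homog.
  rewrite -[e in e.-homog]mul1n; apply: dhomog_msubst; first exact: pihomogP.
  by move=> a; rewrite dhomogX /= mdeg1.
have hE i' (V : 'M[k]_(i', m)) x : h.@[(\row_c (restrict V c).@[x]) 0] =
    (msubst (fun a => restrict V (s a)) (pihomog mdeg e F)).@[x].
  rewrite !meval_msubst; apply: meval_eq => a.
  by rewrite mevalXU mxE.
have pW' := image_param nz.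
apply: ind; exists (pihomog mdeg e F); split=> //.
suff /(vanish_param pW' hh) : vanish h (image_of W').
  move=> E; apply: (mpoly_eq0P char0) => x.
  by rewrite -hE meval_row E meval0.
move=> y yW'; have /sub[_ /(_ e h hh)] : proj_closure (image_of W') y.
  by apply: vincl_proj_closure yW' => a [].
apply=> a [anz [w ->]].
have -> : \row_c (phi c).@[(w *m W) 0] = \row_c (restrict W c).@[w 0].
  apply/rowP => c; rewrite !mxE restrictE; apply: meval_eq => b.
  by congr ((_ *m _) _ _); apply/rowP => a'; rewrite mxE.
by rewrite hE Fe0 meval0.
Qed.

Lemma flag_chain (A : vset k N) q (U : 'M[k]_(q.+1, m)) p :
    row ord0 U = p -> row_free (U *m (jac phi (p 0))^T) ->
    (exists c, (phi c).@[p 0] != 0) ->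
    (forall x, \row_c (phi c).@[x] != 0 -> A (\row_c (phi c).@[x])) ->
  irreducible_chain (proj_closure A) q.
Proof.
move=> Up fr nz phiA.
(* Rows 0 to i of [U]. Every member of the flag contains [p], so all rank conditions can be tested
   at that one point. *)
pose V i : 'M[k]_(i.+1, m) := \matrix_(a, b) U (inord a) b.
have pV i : (i <= q)%N -> delta_mx 0 ord0 *m V i = p.
  move=> le; rewrite -rowE -Up; apply/rowP => b; rewrite !mxE.
  by congr (U _ _); apply: val_inj; rewrite /= inordK.
exists (fun i => proj_closure (image_of (V i))); split=> i le.
  split.
    apply: irreducible_param (@image_param _ (V i) (delta_mx 0 ord0) _).
    by rewrite pV.
  apply: vincl_closure => y [ynz [z E]]; rewrite E; apply: phiA.
  by rewrite -E.
split.
  apply: vincl_closure => y [ynz [z E]]; split=> //.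
  exists (\row_a snoc (fun b => z 0 b) 0 a); rewrite E; apply/rowP => c.
  rewrite !mxE; apply: meval_eq => b; rewrite !mxE [in RHS]big_ord_recr /=.
  rewrite [X in _ + X * _]mxE snoc_max mul0r addr0; apply: eq_bigr => a _.
  by rewrite !mxE snoc_widen.
apply: (image_separated (z := delta_mx 0 ord0)); rewrite pV ?(ltnW le) //.
have -> : V i.+1 = rowsub (fun a : 'I_i.+2 => inord a) U.
  by apply/matrixP => a b; rewrite !mxE.
rewrite -[U in rowsub _ U]mul1mx -mul_rowsub_mx; apply: inj_row_free => w.
set S := rowsub _ 1%:M => w0.
have wS : w *m S = 0.
  by apply: (row_free_inj fr); rewrite /= mul0mx -[RHS]w0 !mulmxA.
apply/rowP => a; have /rowP/(_ (inord a)) := wS.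
rewrite !mxE (bigD1 a) //= !mxE eqxx mulr1 big1 ?addr0 // => b ne.
rewrite !mxE; case: eqP => [E|_]; last by rewrite mulr0.
move/eqP: ne; case; apply: val_inj.
have /= := congr1 val E; rewrite !inordK //.
  by apply: leq_trans (ltn_ord a) _.
by apply: leq_trans (ltn_ord b) _.
Qed.

End Flag.
End Parametrized.

(** * Polar maps and Hessians *)

Section Rank.
Variable k : fieldType.

(** Together with [leq_rank_det] this expresses a lower bound on the rank by the non-vanishing of a
    determinant polynomial in the entries, without choosing rows and columns as for minors. *)
Lemma rank_factor m n q (A : 'M[k]_(m, n)) : (q <= \rank A)%N ->
  exists (U : 'M_(q, m)) (V : 'M_(n, q)), U *m A *m V = 1%:M.
Proof.
move=> le; exists (pid_mx q *m invmx (col_ebase A)),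
  (invmx (row_ebase A) *m pid_mx q).
rewrite -{2}(mulmx_ebase A) !mulmxA mulmxKV ?col_ebase_unit //.
rewrite mulmxK ?row_ebase_unit //.
have [lem len] := (rank_leq_row A, rank_leq_col A).
rewrite !mul_pid_mx -pid_mx_1.
by congr pid_mx; lia.
Qed.

Lemma leq_rank_det m n q (A : 'M[k]_(m, n)) (U : 'M_(q, m)) (V : 'M_(n, q)) :
  \det (U *m A *m V) != 0 -> (q <= \rank A)%N.
Proof.
rewrite -unitfE -unitmxE => /mxrank_unit <-.
exact: leq_trans (mxrankM_maxl _ _) (mxrankM_maxr _ _).
Qed.

Lemma jac_det_poly n N q (g : 'I_n -> {mpoly k[N]}) (U : 'M[k]_(q, n))
    (V : 'M[k]_(N, q)) :
  exists D : {mpoly k[N]}, forall v, D.@[v] = \det (U *m jac g v *m V).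
Proof.
pose C := map_mx (@mpolyC N k).
exists (\det (C _ _ U *m (\matrix_(i, j) (g i)^`M(j)) *m C _ _ V)) => v.
rewrite -det_map_mx !map_mxM /=; congr (\det (_ *m _ *m _)).
- by apply/matrixP => i j; rewrite !mxE mevalC.
- by apply/matrixP => i j; rewrite !mxE.
- by apply/matrixP => i j; rewrite !mxE mevalC.
Qed.

(** Having rank at least [q] is an open condition on the point, so it can be combined with the
    non-vanishing of [h]. *)
Lemma jac_rank_generic (char0 : [pchar k] =i pred0) n N q
    (g : 'I_n -> {mpoly k[N]}) h v :
    (q <= \rank (jac g v))%N -> h != 0 ->
  exists w, (q <= \rank (jac g w))%N /\ h.@[w] != 0.
Proof.
move=> /rank_factor[U [V E]] nz.
have [D DE] := jac_det_poly g U V.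
have Dnz : D != 0.
  suff : D.@[v] != 0 by apply: contraNneq => ->; rewrite meval0.
  by rewrite DE E det1 oner_neq0.
have [w] := mpoly_nonroot char0 (mulf_neq0 Dnz nz).
rewrite mevalM mulf_eq0 negb_or DE => /andP[/leq_rank_det rw hw].
by exists w.
Qed.

Lemma row_free_extend m n q (H : 'M[k]_(m, n)) (p : 'rV_m) :
    p *m H != 0 -> (q < \rank H)%N ->
  exists U : 'M_(q.+1, m), row ord0 U = p /\ row_free (U *m H).
Proof.
(* Besides the line spanned by [p *m H], use [q] independent vectors of a complement of it in the
   row space of [H], lifted through [H]. *)
move=> nz lt; pose a := p *m H; pose D := (H :\: a)%MS.
have ra : \rank a = 1%N by rewrite rank_rV nz.
have rD : (q <= \rank D)%N.
  have := mxrank_cap_compl H a; rewrite -/D.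
  have := mxrankS (capmxSr H a); rewrite ra; lia.
have /submxP[X XE] : (row_base D <= H)%MS by rewrite eq_row_base diffmxSl.
pose W := (pid_mx q : 'M_(q, \rank D)) *m X.
have WH : W *m H = pid_mx q *m row_base D by rewrite XE mulmxA.
have fr : row_free (col_mx p W *m H).
  rewrite mul_col_mx WH /row_free -addsmxE mxrank_disjoint_sum; last first.
    apply/eqP; rewrite -submx0 -(capmx_diff H a) sub_capmx.
    rewrite (submx_trans (capmxSr _ _)) ?capmxSl //.
    by rewrite (submx_trans (submxMl _ _)) // eq_row_base.
  by rewrite -/a ra mxrankMfree ?row_base_free // rank_pid_mx.
exists (col_mx p W : 'M_(1 + q, m)); split; last exact: fr.
rewrite -[RHS](row_id ord0) -(rowKu ord0 p W); congr row.
exact: val_inj.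
Qed.

End Rank.

Section Polar.
Variable k : closedFieldType.
Hypothesis char0 : [pchar k] =i pred0.

Definition hess N (f : {mpoly k[N]}) (x : 'I_N -> k) : 'M[k]_N :=
  jac (fun i => f^`M(i)) x.

Lemma hess_tr N (f : {mpoly k[N]}) x : (hess f x)^T = hess f x.
Proof. by apply/matrixP => i j; rewrite !mxE mderiv_comm. Qed.

(** Euler's identity for the first partial derivatives, which have degree d - 1. *)
Lemma hess_point N (f : {mpoly k[N]}) d (p : 'rV_N) : f \is d.-homog ->
  p *m hess f (p 0) = d.-1%:R *: polar f p.
Proof.
move=> hf; apply/rowP => j; rewrite -hess_tr !mxE.
have := congr1 (meval (p 0)) (euler_mpoly (dhomog_mderiv j hf)).
rewrite mevalMn (raddf_sum (meval (p 0))) /= mulr_natl => <-.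
by apply: eq_bigr => i _; rewrite mevalM mevalXU !mxE.
Qed.

Lemma polar_chain N (f : {mpoly k[N]}) d q x :
    f \is d.-homog -> (2 <= d)%N -> (q < \rank (hess f x))%N ->
  irreducible_chain (polar_image f) q.
Proof.
move=> hf d2 rk.
have [i nzi] : exists i, f^`M(i) != 0.
  apply: NNPP => H; move: rk; rewrite (_ : hess f x = 0) ?mxrank0 //.
  apply/matrixP => i j; rewrite !mxE; have [->|nz] := eqVneq f^`M(i) 0.
    by rewrite mderiv0 meval0.
  by case: H; exists i.
(* The point is moved off the zeros of one partial derivative: the polar map is then defined there,
   and by [hess_point] the Hessian does not kill the point. *)
have [w [rw wi]] := jac_rank_generic char0 rk nzi.
pose p : 'rV[k]_N := \row_b w b.
have pE : p 0 =1 w by move=> b; rewrite mxE.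
have Hp : jac (fun i => f^`M(i)) (p 0) = jac (fun i => f^`M(i)) w.
  by apply/matrixP => a b; rewrite !mxE; apply: meval_eq.
have d1 : (0 < d.-1)%N by lia.
have pH : p *m (jac (fun i => f^`M(i)) (p 0))^T != 0.
  rewrite (hess_tr f) (hess_point _ hf) scaler_eq0 negb_or.
  rewrite (pcharf0P _).1 // -lt0n d1; apply/rV0Pn; exists i.
  by rewrite mxE (meval_eq _ pE).
have [|U [Up fr]] := row_free_extend (q := q) pH; first by rewrite mxrank_tr Hp.
apply: (flag_chain char0 d1 _ Up fr).
- by move=> j; apply: dhomog_mderiv.
- by exists i; rewrite (meval_eq _ pE).
move=> y nz; split=> //; exists (\row_b y b), 1; split; last first.
- by rewrite scale1r; apply/rowP => b; rewrite !mxE; apply: meval_eq => a; rewrite mxE.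
- exact: oner_neq0.
apply: contraNneq nz => y0; apply/eqP/rowP => b; rewrite !mxE.
have -> : f^`M(b).@[y] = f^`M(b).@[fun j => 0 * y j].
  by apply: meval_eq => j; have /rowP/(_ j) := y0; rewrite !mxE mul0r.
by rewrite (meval_dhomog _ _ (dhomog_mderiv b hf)) expr0n eqn0Ngt d1 mul0r.
Qed.

Lemma lin_changeE N (g : 'M[k]_N) (f : {mpoly k[N]}) :
  lin_change g f = restrict (fun _ : 'I_1 => f) g 0.
Proof.
rewrite /lin_change comp_msubst; apply: eq_msubst => i.
by rewrite tnth_mktuple.
Qed.

Lemma meval_lin_change N (g : 'M[k]_N) (f : {mpoly k[N]}) (x : 'rV_N) :
  (lin_change g f).@[x 0] = f.@[(x *m g) 0].
Proof.
rewrite lin_changeE restrictE; apply: meval_eq => i.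
by congr ((_ *m _) _ _); apply/rowP => a; rewrite mxE.
Qed.

Lemma dhomog_lin_change N (g : 'M[k]_N) (f : {mpoly k[N]}) d :
  f \is d.-homog -> lin_change g f \is d.-homog.
Proof.
move=> hf; rewrite lin_changeE -[d in d.-homog]mul1n; apply: dhomog_msubst => //.
move=> b; apply: rpred_sum => a _; apply: rpredZ.
by rewrite dhomogX /= mdeg1.
Qed.

Lemma mderiv_lin_change N (g : 'M[k]_N) (f : {mpoly k[N]}) a :
  (lin_change g f)^`M(a) = \sum_b g a b *: lin_change g f^`M(b).
Proof.
rewrite lin_changeE mderiv_msubst; apply: eq_bigr => b _.
rewrite lin_changeE (raddf_sum (mderiv a)) (bigD1 a) //=.
rewrite big1 ?addr0 => [|c ne]; last first.
  by rewrite mderivZ mderivXU (negPf ne) scaler0.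
by rewrite mderivZ mderivXU eqxx -scalerAr mulr1.
Qed.

Lemma polar_lin_change N (g : 'M[k]_N) (f : {mpoly k[N]}) x :
  polar (lin_change g f) x = polar f (x *m g) *m g^T.
Proof.
apply/rowP => a; rewrite !mxE mderiv_lin_change (raddf_sum (meval _)).
by apply: eq_bigr => b _; rewrite /= mevalZ !mxE meval_lin_change mulrC.
Qed.

Lemma hess_lin_change N (g : 'M[k]_N) (f : {mpoly k[N]}) (x : 'rV_N) :
  hess (lin_change g f) (x 0) = g *m hess f ((x *m g) 0) *m g^T.
Proof.
apply/matrixP => a b; rewrite !mxE mderiv_lin_change (raddf_sum (mderiv b)).
rewrite (raddf_sum (meval _)) /=.
under eq_bigr => c _.
  rewrite mderivZ mevalZ mderiv_lin_change (raddf_sum (meval _)) mulr_sumr.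
  over.
rewrite exchange_big /=; apply: eq_bigr => c _; rewrite !mxE mulr_suml.
apply: eq_bigr => e _; rewrite /= mevalZ meval_lin_change !mxE.
by rewrite mulrCA -mulrA mulrC -!mulrA.
Qed.

End Polar.

(** * The cone [W] *)

Section Indices.
Variables (t s : nat).

(** The first t + 1 and the last s coordinates; [(t + s).+1] is convertible to [t.+1 + s], so the
    block shifts apply without casts. *)
Definition ixl (i : 'I_t.+1) : 'I_(t + s).+1 := lshift s i.
Definition ixr (j : 'I_s) : 'I_(t + s).+1 := rshift t.+1 j.

Lemma ixlE (i : 'I_t.+1) : inord i = ixl i.
Proof.
apply: val_inj; rewrite /= inordK // ltnS.
by rewrite (leq_trans _ (leq_addr _ _)) // -ltnS.
Qed.

Lemma ixl_le i : (ixl i <= t)%N.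
Proof. by rewrite /= -ltnS. Qed.

Lemma ixr_gt j : (t < ixr j)%N.
Proof. by rewrite /= ltnS leq_addr. Qed.

Lemma ixP l : (exists i, l = ixl i) \/ (exists j, l = ixr j).
Proof.
by case: (@split_ordP t.+1 s l) => [i ->|j ->]; [left; exists i | right; exists j].
Qed.

Lemma sum_ix (V : nmodType) (F : 'I_(t + s).+1 -> V) :
  \sum_l F l = \sum_i F (ixl i) + \sum_j F (ixr j).
Proof. exact: (@big_split_ord _ _ _ t.+1 s xpredT F). Qed.

Definition glue T (x : 'I_t.+1 -> T) (y : 'I_s -> T) (l : 'I_(t + s).+1) : T :=
  match split (l : 'I_(t.+1 + s)) with inl i => x i | inr j => y j end.

Lemma glue_ixl T (x : 'I_t.+1 -> T) y i : glue x y (ixl i) = x i.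
Proof. by rewrite /glue /ixl (unsplitK (inl i : 'I_t.+1 + 'I_s)). Qed.

Lemma glue_ixr T (x : 'I_t.+1 -> T) y j : glue x y (ixr j) = y j.
Proof. by rewrite /glue /ixr (unsplitK (inr j : 'I_t.+1 + 'I_s)). Qed.

Lemma ix_neq i j : (ixl i == ixr j) = false.
Proof. by rewrite -val_eqE /= ltn_eqF // ltn_addr. Qed.

Lemma eq_ixl i i' : (ixl i == ixl i') = (i == i').
Proof. by rewrite -val_eqE. Qed.

Lemma eq_ixr j j' : (ixr j == ixr j') = (j == j').
Proof. by rewrite -val_eqE /= eqn_add2l. Qed.

Variable k : closedFieldType.

Lemma last_vars_mderiv (p : {mpoly k[(t + s).+1]}) i :
  in_last_vars t p -> p^`M(ixl i) = 0.
Proof.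
move=> hp; apply/mpolyP => m; rewrite mcoeff_deriv mcoeff0.
rewrite (memN_msupp_eq0 (m := (m + U_(ixl i))%MM)) ?mul0rn //.
apply/negP => /hp/(_ _ (ixl_le i)).
by rewrite mnmDE mnm1E eqxx addn1.
Qed.

Lemma last_vars_eval (p : {mpoly k[(t + s).+1]}) v w :
  in_last_vars t p -> (forall j, v (ixr j) = w (ixr j)) -> p.@[v] = p.@[w].
Proof.
move=> hp vw; rewrite !mevalE big_seq [RHS]big_seq; apply: eq_bigr => m mp.
congr (_ * _); apply: eq_bigr => l _.
case: (ixP l) => -[a ->]; first by rewrite (hp _ mp _ (ixl_le a)) !expr0.
by rewrite vw.
Qed.

End Indices.

(** * Partial derivatives of a P-form, and the affine cone over the image of M *)

Section PForm.
Variable k : closedFieldType.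
Hypothesis char0 : [pchar k] =i pred0.
Variables (t s n d : nat).
Hypothesis s1 : (1 <= s)%N.
Hypothesis n1 : (1 <= n)%N.
Variable D : pdata k (t + s) t n d.
Hypothesis DP : is_pdata D.

Local Notation M := (tnth D.1).
Local Notation P := (tnth D.2).
Local Notation N := (t + s).+1.
Local Notation ixl := (@ixl t s).
Local Notation ixr := (@ixr t s).

Lemma M_homog i : M i \is (n - 1).-homog. Proof. by case: DP => /(_ i)[]. Qed.
Lemma M_last i : in_last_vars t (M i). Proof. by case: DP => /(_ i)[]. Qed.
Lemma P_homog j : P j \is (d - j * n).-homog. Proof. by case: DP => _ _ /(_ j)[]. Qed.
Lemma P_last j : in_last_vars t (P j). Proof. by case: DP => _ _ /(_ j)[]. Qed.

Lemma pQ_homog : pQ D \is n.-homog.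
Proof.
apply: rpred_sum => i _; rewrite -{2}(subnK n1); apply: dhomogM; first exact: M_homog.
by rewrite dhomogX /= mdeg1.
Qed.

Lemma pform_homog : pform D \is d.-homog.
Proof.
apply: rpred_sum => j _.
have E : (n * j + (d - j * n))%N = d.
  rewrite mulnC subnKC //; apply: leq_trans (leq_divM d n).
  by rewrite leq_mul2r -ltnS ltn_ord orbT.
by have := dhomogM (dhomogMn j pQ_homog) (P_homog j); rewrite E.
Qed.

Lemma pQ_mderivl i : (pQ D)^`M(ixl i) = M i.
Proof.
rewrite /pQ (raddf_sum (mderiv _)) (bigD1 i) //= big1 ?addr0 => [|i' ne].
  rewrite mderivM (last_vars_mderiv _ (@M_last i)) mul0r add0r ixlE.
  by rewrite mderivXU eqxx mulr1.
rewrite mderivM (last_vars_mderiv _ (@M_last i')) mul0r add0r ixlE.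
by rewrite mderivXU eq_ixl (negPf ne) mulr0.
Qed.

Lemma pform_mderivl : exists R, forall i, (pform D)^`M(ixl i) = M i * R.
Proof.
rewrite /pform; elim/big_ind: _ => [|p q [R1 E1] [R2 E2]|j _].
- by exists 0 => i; rewrite mderiv0 mulr0.
- by exists (R1 + R2) => i; rewrite mderivD E1 E2 mulrDr.
have [R RE] : exists R, forall i, (pQ D ^+ j)^`M(ixl i) = M i * R.
  elim: (nat_of_ord j) => [|e [R RE]].
    by exists 0 => i; rewrite expr0 -mpolyC1 mderivC mulr0.
  exists (pQ D ^+ e + pQ D * R) => i.
  by rewrite exprS mderivM RE pQ_mderivl mulrDr mulrCA.
exists (R * P j) => i.
by rewrite mderivM RE (last_vars_mderiv _ (@P_last j)) mulr0 addr0 mulrA.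
Qed.

Lemma polar_first x : exists c, forall i,
  polar (pform D) x 0 (ixl i) = c * (M i).@[x 0].
Proof.
have [R RE] := pform_mderivl; exists R.@[x 0] => i.
by rewrite mxE RE mevalM mulrC.
Qed.

(** For turning a Hessian rank above [s] into the existence of a non-zero [M_i]. *)
Lemma rank_hess_M0 x : (forall i, M i = 0) -> (\rank (hess (pform D) x) <= s)%N.
Proof.
move=> M0; have [R RE] := pform_mderivl.
pose H : 'M[k]_(t.+1 + s, N) := hess (pform D) x.
have U0 : usubmx H = 0.
  by apply/matrixP => i j; rewrite !mxE -/(ixl i) RE M0 mul0r mderiv0 meval0.
have E : \rank H = \rank (col_mx (usubmx H) (dsubmx H)) by rewrite vsubmxK.
by rewrite -[hess _ _]/H E U0 rank_col_0mx rank_leq_row.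
Qed.

Lemma M_const i v w : n = 1%N -> (M i).@[v] = (M i).@[w].
Proof.
move=> nE; have n0 : (n - 1 = 0)%N by rewrite nE.
have h0 := M_homog i; rewrite n0 in h0.
have E u : (M i).@[u] = (M i).@[fun j => 0 * u j].
  by rewrite (meval_dhomog _ _ h0) expr0 mul1r.
by rewrite E [RHS]E; apply: meval_eq => j; rewrite !mul0r.
Qed.

Definition conedim : nat := if n == 1%N then 1 else s.

(* The affine cone over the image of [M]: for [n = 1] it is the line spanned by
   the constants [M_i]; for [n > 1] a factor [c] is absorbed by rescaling the
   argument. *)
Lemma M_cone_param : exists q : 'I_t.+1 -> {mpoly k[conedim]},
  [/\ forall c (x : 'rV_N), exists z, forall i, (q i).@[z] = c * (M i).@[x 0],
      forall z, (exists i, (q i).@[z] != 0) -> exists c (x : 'rV_N),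
        [/\ x != 0, forall i, x 0 (ixl i) = 0, exists i, (M i).@[x 0] != 0
          & forall i, (q i).@[z] = c * (M i).@[x 0]]
    & (exists i, M i != 0) -> exists i, q i != 0].
Proof.
rewrite /conedim; have [nE|nE] := eqVneq n 1%N.
  have MC i v w := M_const i v w nE.
  pose q i : {mpoly k[1]} := (M i).@[fun=> 0] *: 'X_ord0.
  have qE i z : (q i).@[z] = z ord0 * (M i).@[fun=> 0].
    by rewrite mevalZ mevalXU mulrC.
  exists q; split.
  - move=> c x; exists (fun=> c) => i.
    by rewrite qE (MC i _ (x 0)).
  - move=> z [i]; rewrite qE mulf_eq0 negb_or => /andP[_ nz].
    exists (z ord0), (\row_l glue (fun=> 0) (fun=> 1) l); split.
    + apply/rV0Pn; exists (ixr (Ordinal s1)).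
      by rewrite mxE glue_ixr oner_neq0.
    + by move=> j; rewrite mxE glue_ixl.
    + by exists i; rewrite (MC i _ (fun=> 0)).
    by move=> j; rewrite qE; congr (_ * _); apply: MC.
  case=> i nz; exists i; rewrite /q scaler_eq0 negb_or.
  have [v] := mpoly_nonroot char0 nz; rewrite (MC i _ (fun=> 0)) => -> /=.
  by rewrite -msize_poly_eq0 msizeX.
have n2 : (0 < n - 1)%N by rewrite subn_gt0 ltn_neqAle eq_sym nE.
pose q i : {mpoly k[s]} := msubst (glue (fun=> 0) (fun j => 'X_j)) (M i).
have qE i z : (q i).@[z] = (M i).@[glue (fun=> 0) z].
  rewrite meval_msubst; apply: meval_eq => l; case: (ixP l) => -[a ->].
    by rewrite !glue_ixl meval0.
  by rewrite !glue_ixr mevalXU.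
exists q; split.
- move=> c x; have [b ->] := closed_exp_root c n2.
  exists (fun j => b * x 0 (ixr j)) => i.
  rewrite qE -(meval_dhomog _ _ (M_homog i)).
  by apply: last_vars_eval (@M_last i) _ => j; rewrite glue_ixr.
- move=> z [i nz]; pose x : 'rV[k]_N := \row_l glue (fun=> 0) z l.
  have xE : x 0 =1 glue (fun=> 0) z by move=> l; rewrite mxE.
  exists 1, x; split.
  + apply: contraNneq nz => x0; rewrite qE.
    have -> : (M i).@[glue (fun=> 0) z] = (M i).@[fun l => 0 * z (Ordinal s1)].
      by apply: meval_eq => l; rewrite -xE x0 mxE mul0r.
    by rewrite (meval_dhomog _ _ (M_homog i)) expr0n eqn0Ngt n2 mul0r.
  + by move=> j; rewrite xE glue_ixl.
  + by exists i; rewrite (meval_eq _ xE) -qE.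
  by move=> j; rewrite mul1r qE (meval_eq _ xE).
case=> i nz; exists i; have [v] := mpoly_nonroot char0 nz.
apply: contraNneq => q0.
have := qE i (fun j => v (ixr j)); rewrite q0 meval0 => ->; apply/eqP.
by apply: last_vars_eval (@M_last i) _ => j; rewrite glue_ixr.
Qed.

End PForm.

(** * Equations and parametrization of W, and its comparison with Z *)

Section Cone.
Variable k : closedFieldType.
Hypothesis char0 : [pchar k] =i pred0.
Variables (t s n d : nat).
Hypothesis s1 : (1 <= s)%N.
Hypothesis n1 : (1 <= n)%N.
Hypothesis n_lt_d : (n < d)%N.
Hypothesis t1 : (1 <= t)%N.
Variable D : pdata k (t + s) t n d.
Hypothesis DP : is_pdata D.
Variable g : 'M[k]_((t + s).+1).
Hypothesis gU : g \in unitmx.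

Local Notation M := (tnth D.1).
Local Notation N := (t + s).+1.
Local Notation ixl := (@ixl t s).
Local Notation ixr := (@ixr t s).
Local Notation f := (lin_change g (pform D)).

Definition Wbody : vset k N := fun a => exists xi : 'rV[k]_N,
  [/\ cocore t g xi, exists i, Mval D g xi i != 0 & perp (Gamma D g xi) a].

Local Notation co a := (a *m invmx g^T).

(** Hyperplanes transform contragrediently: [co a] holds the dual coordinates of [a] in the frame
    where the form is standard. *)
Lemma pairing_frame (a x : 'rV[k]_N) :
  \sum_i a 0 i * x 0 i = \sum_l (co a) 0 l * (x *m g) 0 l.
Proof.
have dotE (u w : 'rV[k]_N) : \sum_i u 0 i * w 0 i = (u *m w^T) 0 0.
  by rewrite mxE; apply: eq_bigr => i _; rewrite mxE.
by rewrite !dotE trmx_mul mulmxA mulmxKV // unitmx_tr.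
Qed.

(** A hyperplane contains [Gamma_xi] exactly when its equation, restricted to the core, is a
    possibly zero multiple of the equation of [Gamma_xi]. *)
Lemma WbodyP a : Wbody a <-> a != 0 /\ exists c (x : 'rV_N),
  [/\ x != 0, forall i, x 0 (ixl i) = 0, exists i, (M i).@[x 0] != 0
    & forall i, (co a) 0 (ixl i) = c * (M i).@[x 0]].
Proof.
split=> [[xi [[xinz xi0] [i0 Mi0] [anz aG]]]|[anz [c [x [xnz x0 [i0 Mi0] aE]]]]].
  split=> //; exists ((co a) 0 (ixl i0) / Mval D g xi i0), (xi *m g); split.
  - by rewrite -(mul0mx 1 g) (can_eq (mulmxK gU)).
  - by move=> i; apply: xi0; apply: ixl_le.
  - by exists i0.
  move=> i; rewrite mulrAC; apply: (canRL (mulfK Mi0)).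
  have [->//|ne] := eqVneq i i0.
  (* The test point [M_i0 e_i - M_i e_i0] lies in [Gamma_xi]; pairing it with [a] gives the
     proportionality of the coordinates i and i0. *)
  pose y : 'rV[k]_N := Mval D g xi i0 *: delta_mx 0 (ixl i)
                     - Mval D g xi i *: delta_mx 0 (ixl i0).
  have yE l : y 0 l = Mval D g xi i0 *+ (l == ixl i) - Mval D g xi i *+ (l == ixl i0).
    by rewrite !mxE !eqxx /= !mulr_natr.
  have := aG (y *m invmx g) _; rewrite pairing_frame mulmxKV // => /(_ _)/eqP.
  under eq_bigr => l _ do rewrite yE mulrBr.
  rewrite sumrB.
  rewrite (bigD1 (ixl i)) //= eqxx big1 ?addr0 => [|l /negPf->]; last by rewrite mulr0.
  rewrite (bigD1 (ixl i0)) //= eqxx big1 ?addr0 => [|l /negPf->]; last by rewrite mulr0.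
  rewrite subr_eq0 => H; apply/eqP; apply: H; split.
    split.
      rewrite -(mul0mx 1 (invmx g)) (can_eq (mulmxKV gU)).
      apply: contraNneq Mi0 => y0; have := yE (ixl i).
      by rewrite y0 mxE eqxx eq_ixl (negPf ne) subr0 mulr1n => <-.
    move=> l lt; rewrite mulmxKV // yE.
    have ltn (j : 'I_t.+1) : (l == ixl j) = false.
      by apply/negP => /eqP E; move: lt; rewrite E ltnNge ixl_le.
    by rewrite !ltn subr0.
  under eq_bigr => l _ do rewrite mulmxKV // ixlE yE !eq_ixl mulrBr.
  rewrite sumrB (bigD1 i) //= eqxx big1 ?addr0 => [|l /negPf->]; last by rewrite mulr0.
  rewrite (bigD1 i0) //= eqxx big1 ?addr0 => [|l /negPf->]; last by rewrite mulr0.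
  by rewrite mulrC subrr.
exists (x *m invmx g); split.
- split; first by rewrite -(mul0mx 1 (invmx g)) (can_eq (mulmxKV gU)).
  move=> l le; rewrite mulmxKV //.
  by case: (ixP l) le => -[j ->]; rewrite ?x0 // leqNgt ixr_gt.
- by exists i0; rewrite /Mval mulmxKV.
split=> // y [[_ y0] yM]; rewrite pairing_frame sum_ix.
rewrite [X in _ + X]big1 ?addr0 => [|j _]; last by rewrite y0 ?mulr0 ?ixr_gt.
have := congr1 ( *%R c) yM; rewrite mulr0 mulr_sumr; apply: etrans.
apply: eq_bigr => i _.
by rewrite aE /Mval mulmxKV // ixlE mulrA.
Qed.

Lemma Wbody_cone : is_cone Wbody.
Proof.
move=> a c cnz /WbodyP[anz [e [x [xnz x0 Mx aE]]]]; apply/WbodyP.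
split; first by rewrite scaler_eq0 negb_or cnz.
exists (c * e), x; split=> // i.
by rewrite -scalemxAl mxE aE mulrA.
Qed.

Lemma Wbody_nz a : Wbody a -> a != 0. Proof. by case/WbodyP. Qed.


(** The cone over the image of M supplies the first t + 1 dual coordinates and the last s are free.
    Polar values get their own clause because they may be zero or come from a point where all [M_i]
    vanish. *)
Lemma Wbody_param : (exists i, M i != 0) ->
  exists psi : 'I_N -> {mpoly k[conedim s n + s]},
    [/\ parametrizes Wbody psi,
        forall a, Wbody a -> exists z, a = \row_i (psi i).@[z]
      & forall x, exists z, polar f x = \row_i (psi i).@[z]].
Proof.
move=> Mnz; have [q [qsurj qW /(_ Mnz)[i0 qi0]]] := M_cone_param char0 s1 n1 DP.
pose beta := glue (fun i => msubst (fun b => 'X_(lshift s b)) (q i))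
                  (fun j => 'X_(rshift (conedim s n) j)) : 'I_N -> {mpoly k[_]}.
pose psi i := \sum_l g i l *: beta l.
have psiE z : \row_i (psi i).@[z] = (\row_l (beta l).@[z]) *m g^T.
  apply/rowP => i; rewrite !mxE (raddf_sum (meval z)); apply: eq_bigr => l _.
  by rewrite !mxE mulrC /= mevalZ.
have betal z i : (beta (ixl i)).@[z] = (q i).@[fun b => z (lshift s b)].
  by rewrite /beta glue_ixl meval_msubst; apply: meval_eq => b; rewrite mevalXU.
have betar z j : (beta (ixr j)).@[z] = z (rshift _ j).
  by rewrite /beta glue_ixr mevalXU.
have gTU : g^T \in unitmx by rewrite unitmx_tr.
have surj (a : 'rV_N) c (x : 'rV_N) :
    (forall i, (co a) 0 (ixl i) = c * (M i).@[x 0]) ->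
    exists z, a = \row_i (psi i).@[z].
  move=> aE; have [w wE] := qsurj c x.
  exists (fun b => match split b with inl b' => w b' | inr j => (co a) 0 (ixr j) end).
  rewrite psiE; apply: (canRL (mulmxKV gTU)).
  apply/rowP => l; rewrite [in RHS]mxE; case: (ixP l) => -[j ->].
    rewrite betal aE -wE; apply: meval_eq => b.
    by rewrite (unsplitK (inl b : 'I_(conedim s n) + 'I_s)).
  by rewrite betar (unsplitK (inr j : 'I_(conedim s n) + 'I_s)).
have sub a : Wbody a -> exists z, a = \row_i (psi i).@[z].
  by case/WbodyP => _ [c [x [_ _ _ aE]]]; apply: surj aE.
exists psi; split=> //; last first.
  move=> x; have [c cE] := polar_first DP (x *m g).
  apply: (surj _ c (x *m g)) => i.
  by rewrite polar_lin_change mulmxK.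
split; last first.
  move=> a Wa; split; first exact: Wbody_nz.
  by have [z ->] := sub a Wa; exists 1, z; rewrite scale1r.
exists (beta (ixl i0)).
  have [v vq] := mpoly_nonroot char0 qi0.
  pose z (b : 'I_(conedim s n + s)) : k :=
    match split b with inl b' => v b' | inr j => 0 end.
  suff : (beta (ixl i0)).@[z] != 0 by apply: contraNneq => ->; rewrite meval0.
  rewrite betal; apply: contraNneq vq => <-; apply/eqP; apply: meval_eq => b.
  by rewrite /z (unsplitK (inl b : 'I_(conedim s n) + 'I_s)).
move=> z nz; apply/WbodyP.
have coE : co (\row_i (psi i).@[z]) = \row_l (beta l).@[z] by rewrite psiE mulmxK.
split.
  apply: contraNneq nz => a0; move: coE; rewrite a0 mul0mx => /rowP/(_ (ixl i0)).
  by rewrite !mxE => <-.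
move: nz; rewrite betal => nz.
have [|c [x [xnz x0 Mx qx]]] := qW (fun b => z (lshift s b)); first by exists i0.
exists c, x; split=> // i.
by rewrite coE mxE betal.
Qed.

(** The relation between the [M_i] may be inhomogeneous. It still holds for [c M_i(x)], since [c]
    has an (n - 1)-th root by which [x] can be scaled. *)
Lemma Wbody_hypersurface : n != 1%N ->
  exists G : {mpoly k[N]}, G != 0 /\ vanish G Wbody.
Proof.
move=> nE; have [_ [F [Fnz Fz]] _] := DP.
have n2 : (0 < n - 1)%N by rewrite subn_gt0 ltn_neqAle eq_sym nE.
have gTU : g^T \in unitmx by rewrite unitmx_tr.
pose G := msubst (fun i => \sum_l invmx g^T l (ixl i) *: 'X_l) F.
have GE (a : 'rV_N) : G.@[a 0] = F.@[fun i => (co a) 0 (ixl i)].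
  rewrite meval_msubst; apply: meval_eq => i.
  rewrite (raddf_sum (meval (a 0))) mxE; apply: eq_bigr => l _.
  by rewrite /= mevalZ mevalXU mulrC.
exists G; split.
  have [v vF] := mpoly_nonroot char0 Fnz.
  pose a : 'rV[k]_N := (\row_l glue v (fun=> 0) l) *m g^T.
  suff : G.@[a 0] != 0 by apply: contraNneq => ->; rewrite meval0.
  rewrite GE; apply: contraNneq vF => <-; apply/eqP; apply: meval_eq => i.
  by rewrite mulmxK // mxE glue_ixl.
move=> a /WbodyP[_ [c [x [_ _ _ aE]]]]; rewrite GE.
have [b cE] := closed_exp_root c n2.
have := congr1 (meval (fun l => b * x 0 l)) Fz.
rewrite comp_msubst meval0 meval_msubst; apply: etrans; apply: meval_eq => i.
by rewrite aE cE (meval_dhomog _ _ (M_homog DP i)).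
Qed.

(** Dimension of the affine cone over W. For n > 1, [t + s] is one less than the number of
    coordinates, owing to the relation, and [s + s] counts the parameters; for n = 1 there are s + 1
    parameters. *)
Definition target_rank : nat := if n == 1%N then s.+1 else minn (t + s) (s + s).

Lemma polar_image_Wcone x :
    (target_rank <= \rank (hess (pform D) x))%N ->
  vequal (polar_image f) (Wcone D g) /\ has_dim (polar_image f) target_rank.-1.
Proof.
have gTU : g^T \in unitmx by rewrite unitmx_tr.
have rho1 : (s < target_rank)%N by rewrite /target_rank; case: eqP => _; lia.
move=> rk; have Mnz : exists i, M i != 0.
  apply: NNPP => H.
  have M0 i : M i = 0.
    by apply/eqP; apply: contraT => nz; case: H; exists i.
  have := leq_trans rk (rank_hess_M0 DP x M0).
  by rewrite leqNgt rho1.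
have [psi [ppsi Wpsi polpsi]] := Wbody_param Mnz.
have hf : f \is d.-homog by apply: dhomog_lin_change (pform_homog n1 DP).
apply: (@closure_eq_of_chain k N _ Wbody).
(* A form vanishing on W pulls back to zero along [psi], and every polar value is a value of
   [psi]. *)
- move=> y [ynz H]; split=> // e p hp pW; apply: H (hp) _ => a [_ [w [c [_ _ ->]]]].
  have [z ->] := polpsi w.
  rewrite meval_scale (meval_dhomog _ _ hp) meval_row.
  by rewrite ((vanish_param char0 ppsi hp).1 pW) meval0 mulr0.
- exact: (irreducible_param char0 ppsi).
- pose w : 'rV[k]_N := (\row_l x l) *m invmx g.
  apply: (polar_chain char0 (x := w 0) hf); first by lia.
  rewrite hess_lin_change // mulmxKV //.
  have -> : hess (pform D) ((\row_l x l) 0) = hess (pform D) x.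
    by apply/matrixP => a b; rewrite !mxE; apply: meval_eq => l; rewrite mxE.
  rewrite mxrankMfree ?row_free_unit //.
  rewrite (eqmxMfull _ (_ : row_full g)) ?row_full_unit //.
  by rewrite prednK // (leq_ltn_trans _ rho1).
move=> l chl; have lt := chain_le_param char0 Wbody_cone Wpsi chl.
rewrite -ltnS prednK; last by rewrite (leq_ltn_trans _ rho1).
rewrite /target_rank; move: lt; rewrite /conedim; have [nE|nE] := eqVneq n 1%N.
  by rewrite add1n.
have [G [Gnz GW]] := Wbody_hypersurface nE.
have := chain_le_hypersurface char0 Wbody_cone Gnz GW chl.
lia.
Qed.

End Cone.

(** * Data with a Hessian of large rank *)

Section Bordered.
Variables (k : fieldType) (t s : nat).
Local Notation ixl := (@ixl t s).
Local Notation ixr := (@ixr t s).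

Lemma full_rank_minor m n (A : 'M[k]_(m, n)) :
  exists (f : 'I_(\rank A) -> 'I_m) (g : 'I_(\rank A) -> 'I_n),
    injective g /\ mxsub f g A \in unitmx.
Proof.
pose f := maxrankfun A; have fr := maxrowsub_free A.
have full : row_full (rowsub f A)^T by rewrite /row_full mxrank_tr (eqP fr).
exists f, (fullrankfun full); split; first exact: fullrankfun_inj.
have := fullrowsub_unit full; rewrite -unitmx_tr; congr (_ \in unitmx).
by apply/matrixP => i j; rewrite !mxE.
Qed.

(** The rows [f] of the first block and all rows of the last are independent. In a vanishing
    combination, columns [g], where [c] is zero, kill the coefficients of the first kind; the other
    last columns kill those outside [g]; the first columns [f] kill the rest. *)
Lemma rank_bordered (B : 'M[k]_(t.+1, s)) (f : 'I_(\rank B) -> 'I_t.+1)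
    (g : 'I_(\rank B) -> 'I_s) (H : 'M[k]_((t + s).+1)) (c : 'I_s -> k) :
    injective g -> mxsub f g B \in unitmx ->
    (forall i i', H (ixl i) (ixl i') = 0) ->
    (forall i j, H (ixl i) (ixr j) = B i j) ->
    (forall i j, H (ixr j) (ixl i) = B i j) ->
    (forall j j', H (ixr j) (ixr j') = c j *+ (j == j')) ->
    (forall j, (c j == 0) = (j \in codom g)) ->
  (\rank B + s <= \rank H)%N.
Proof.
move=> ginj fgU Hll Hlr Hrl Hrr c0.
pose h (a : 'I_(\rank B + s)) : 'I_(t + s).+1 :=
  match split a with inl a' => ixl (f a') | inr j => ixr j end.
have hl a : h (lshift s a) = ixl (f a).
  by rewrite /h (unsplitK (inl a : 'I_(\rank B) + 'I_s)).
have hr j : h (rshift _ j) = ixr j.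
  by rewrite /h (unsplitK (inr j : 'I_(\rank B) + 'I_s)).
suff fr : row_free (rowsub h H).
  rewrite -[X in (X <= _)%N](eqP fr) -[H in rowsub h H]mul1mx -mul_rowsub_mx.
  exact: mxrankM_maxr.
apply: inj_row_free => w wH.
have wE l : \sum_a w 0 (lshift s a) * H (ixl (f a)) l +
            \sum_j w 0 (rshift _ j) * H (ixr j) l = 0.
  have := congr1 (fun A : 'rV_ _ => A 0 l) wH; rewrite !mxE big_split_ord /=.
  apply: etrans; congr (_ + _); apply: eq_bigr => a _; rewrite !mxE.
    by rewrite hl.
  by rewrite hr.
have diag j : \sum_j' w 0 (rshift _ j') * H (ixr j') (ixr j) =
              w 0 (rshift _ j) * c j.
  rewrite (bigD1 j) //= Hrr eqxx big1 ?addr0 // => j' ne.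
  by rewrite Hrr (negPf ne) mulr0.
have wl a : w 0 (lshift s a) = 0.
  suff : \row_a w 0 (lshift s a) = 0 by move/rowP/(_ a); rewrite !mxE.
  apply: (can_inj (mulmxK fgU)); rewrite mul0mx; apply/rowP => b.
  have := wE (ixr (g b)); rewrite diag.
  have /eqP -> : c (g b) == 0 by rewrite c0 codom_f.
  rewrite mulr0 addr0 => E; rewrite [RHS]mxE; apply: etrans E.
  rewrite mxE; apply: eq_bigr => a' _.
  by rewrite !mxE Hlr.
have wr0 j : j \notin codom g -> w 0 (rshift _ j) = 0.
  rewrite -c0 => cj; have := wE (ixr j); rewrite diag big1 ?add0r => [/eqP|a _].
    by rewrite mulf_eq0 (negPf cj) orbF => /eqP.
  by rewrite wl mul0r.
have wr a : w 0 (rshift _ (g a)) = 0.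
  suff : \col_a w 0 (rshift _ (g a)) = 0.
    by move/colP/(_ a); rewrite !mxE.
  apply: (can_inj (mulKmx fgU)); rewrite mulmx0; apply/colP => b.
  have := wE (ixl (f b)); rewrite big1 ?add0r => [E|a' _]; last by rewrite wl mul0r.
  rewrite [RHS]mxE; apply: etrans E; rewrite mxE.
  rewrite (bigID (mem (codom g))) /= [X in _ = _ + X]big1 ?addr0; last first.
    by move=> j /wr0 ->; rewrite mul0r.
  rewrite (eq_bigl (mem (g @: setT))); last first.
    move=> j; apply/codomP/imsetP => [[a' ->]|[a' _ ->]]; first by exists a'.
    by exists a'.
  rewrite big_imset /=; last by move=> ? ? _ _ /ginj.
  apply: eq_big => [a'|a' _]; first by rewrite !inE.
  by rewrite !mxE Hrl mulrC.
apply/rowP => a; rewrite mxE; case: (split_ordP a) => [b ->|j ->]; first exact: wl.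
by have [/codomP[b ->]|/wr0//] := boolP (j \in codom g); apply: wr.
Qed.

End Bordered.

Lemma mderiv_Xexp (R : comNzRingType) N (a b : 'I_N) e :
  ('X_a ^+ e : {mpoly R[N]})^`M(b) = (e%:R *: 'X_a ^+ e.-1) *+ (a == b).
Proof.
rewrite !mpolyXn mderivX mulmnE mnm1E; have [<-|ne] := eqVneq a b; last first.
  by rewrite mul0n scale0r.
rewrite mul1n; case: e => [|e]; first by rewrite !scale0r.
congr (_ *: 'X_[_]); apply/mnmP => c.
by rewrite mnmBE !mulmnE mnm1E /= mulnS addnC addnK.
Qed.

Section LastVars.
Variables (k : closedFieldType) (t s : nat).
Local Notation N := (t + s).+1.

Lemma last_vars0 : in_last_vars t (0 : {mpoly k[N]}).
Proof. by move=> m; rewrite msupp0. Qed.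

Lemma last_varsD (p q : {mpoly k[N]}) :
  in_last_vars t p -> in_last_vars t q -> in_last_vars t (p + q).
Proof.
by move=> hp hq m /msuppD_le; rewrite mem_cat => /orP[/hp|/hq].
Qed.

Lemma last_varsZ c (p : {mpoly k[N]}) : in_last_vars t p -> in_last_vars t (c *: p).
Proof. by move=> hp m /msuppZ_le/hp. Qed.

Lemma last_varsX j e : in_last_vars t ('X_(ixr t j) ^+ e : {mpoly k[N]}).
Proof.
move=> m; rewrite mpolyXn msuppX inE => /eqP -> i le.
rewrite mulmnE mnm1E; have [E|] := eqVneq; last by rewrite mul0n.
by move: le; rewrite -E leqNgt ixr_gt.
Qed.

Lemma last_vars_deriv (p : {mpoly k[N]}) l :
  in_last_vars t p -> in_last_vars t p^`M(l).
Proof.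
move=> hp m; rewrite mcoeff_msupp mcoeff_deriv => nz i le.
have /hp/(_ i le) : (m + U_(l))%MM \in msupp p.
  by rewrite mcoeff_msupp; apply: contraNneq nz => ->; rewrite mul0rn.
by rewrite mnmDE; case: (m i).
Qed.

End LastVars.

Section GoodData.
Variable k : closedFieldType.
Hypothesis char0 : [pchar k] =i pred0.
Variables (t s n d : nat).
Hypothesis s1 : (1 <= s)%N.
Hypothesis n1 : (1 <= n)%N.
Hypothesis n_lt_d : (n < d)%N.
Local Notation N := (t + s).+1.
Local Notation ixl := (@ixl t s).
Local Notation ixr := (@ixr t s).
Variable T : t.+1.-tuple {mpoly k[N]}.
Hypothesis TP : forall i, tnth T i \is (n - 1).-homog /\ in_last_vars t (tnth T i).
Hypothesis Tdep : alg_dependent T.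
Variable x : 'I_N -> k.
Hypothesis xl : forall i, x (ixl i) = 0.
Hypothesis xr : forall j, x (ixr j) != 0.

Local Notation jl := (Ordinal s1).
Definition good_p1 : {mpoly k[N]} := 'X_(ixr jl) ^+ (d - n).

(** Without terms of index above 1 the form is affine in the first t + 1 variables. [P_1] is a pure
    power so that it is non-zero at [x]. *)
Definition good_P (p0 : {mpoly k[N]}) : (d %/ n).+1.-tuple {mpoly k[N]} :=
  [tuple if j == 0 :> nat then p0 else if j == 1 :> nat then good_p1 else 0
    | j < (d %/ n).+1].

Lemma good_pdata p0 : p0 \is d.-homog -> in_last_vars t p0 ->
  is_pdata ((T, good_P p0) : pdata k (t + s) t n d).
Proof.
move=> hp0 lp0; split=> //= j; rewrite tnth_mktuple.
have [->|j0] := eqVneq (j : nat) 0%N; first by rewrite mul0n subn0.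
have [->|j1] := eqVneq (j : nat) 1%N.
  rewrite mul1n; split; last exact: last_varsX.
  exact: dhomog_Xexp.
by split; [exact: dhomog0 | exact: last_vars0].
Qed.

Lemma good_pform p0 :
  pform ((T, good_P p0) : pdata k (t + s) t n d) =
  p0 + \sum_i tnth T i * good_p1 * 'X_(ixl i).
Proof.
rewrite /pform big_ord_recl /= tnth_mktuple eqxx mul1r; congr (_ + _).
have -> : \sum_i tnth T i * good_p1 * 'X_(ixl i) =
    pQ ((T, good_P p0) : pdata k (t + s) t n d) * good_p1.
  rewrite mulr_suml; apply: eq_bigr => i _.
  by rewrite ixlE mulrAC.
have : (0 < d %/ n)%N by rewrite divn_gt0 // ltnW.
set Q := pQ _; rewrite /good_P; case: (d %/ n)%N Q => // e Q _.
rewrite big_ord_recl /= tnth_mktuple /= expr1 big1 ?addr0 // => j _.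
by rewrite tnth_mktuple mulr0.
Qed.

Lemma good_p1_nz : good_p1.@[x] != 0.
Proof. by rewrite rmorphXn /= mevalXU expf_neq0. Qed.

(** The mixed block of the Hessian: the i-th partial derivative of the form is [M_i P_1]. *)
Definition Bmat : 'M[k]_(t.+1, s) :=
  \matrix_(i, j) (tnth T i * good_p1)^`M(ixr j).@[x].

Lemma Mp1_last i : in_last_vars t (tnth T i * good_p1).
Proof.
move=> m /msuppM_le /allpairsP[[m1 m2] /= [h1 h2 ->]] l le.
by rewrite mnmDE ((TP i).2 _ h1 _ le) (last_varsX h2 le).
Qed.

Lemma Bmat_euler i :
  \sum_j x (ixr j) * Bmat i j = (d.-1)%:R * (tnth T i).@[x] * good_p1.@[x].
Proof.
have h : tnth T i * good_p1 \is (d.-1).-homog.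
  have -> : d.-1 = (n - 1 + (d - n))%N by lia.
  apply: dhomogM; first exact: (TP i).1.
  exact: dhomog_Xexp.
have := congr1 (meval x) (euler_mpoly h).
rewrite mevalMn mevalM -mulrA mulr_natl => <-.
rewrite (raddf_sum (meval x)) sum_ix /= [X in _ = X + _]big1 ?add0r => [|i' _].
  by apply: eq_bigr => j _; rewrite mevalM mevalXU mxE.
by rewrite mevalM mevalXU xl mul0r.
Qed.

Lemma dpred_nz : (d.-1)%:R != 0 :> k.
Proof. by rewrite (pcharf0P _).1 // -lt0n; lia. Qed.

(** One has [P_1 dM_i = d(M_i P_1) - M_i dP_1], and by Euler's identity the value [M_i P_1] is
    itself a fixed combination of the entries of row i of [Bmat]. So [dM_i] is a linear function of
    that row; [G] is its matrix. *)
Lemma rank_jac_Bmat : (\rank (jac (tnth T) x) <= \rank Bmat)%N.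
Proof.
pose G : 'M[k]_(s, N) := \matrix_(j, l) (((ixr j == l)%:R
  - x (ixr j) * good_p1^`M(l).@[x] / ((d.-1)%:R * good_p1.@[x])) / good_p1.@[x]).
suff -> : jac (tnth T) x = Bmat *m G by apply: mxrankM_maxl.
have p1nz := good_p1_nz; have dnz := dpred_nz.
apply/matrixP => i l; rewrite !mxE.
under eq_bigr => j _ do rewrite [G _ _]mxE mulrA mulrBr.
rewrite -mulr_suml; apply: (canRL (mulfK p1nz)).
rewrite sumrB.
have -> : \sum_j Bmat i j *
    (x (ixr j) * good_p1^`M(l).@[x] / ((d.-1)%:R * good_p1.@[x])) =
    (tnth T i).@[x] * good_p1^`M(l).@[x].
  transitivity ((\sum_j x (ixr j) * Bmat i j) *
      (good_p1^`M(l).@[x] / ((d.-1)%:R * good_p1.@[x]))).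
    by rewrite mulr_suml; apply: eq_bigr => j _; rewrite !mulrA [Bmat i j * _]mulrC.
  rewrite Bmat_euler; move: (d.-1%:R : k) dnz => e enz.
  by field; rewrite p1nz.
apply/eqP; rewrite eq_sym subr_eq; apply/eqP.
have -> : (tnth T i)^`M(l).@[x] * good_p1.@[x] + (tnth T i).@[x] * good_p1^`M(l).@[x]
  = (tnth T i * good_p1)^`M(l).@[x] by rewrite mderivM mevalD !mevalM.
case: (ixP l) => -[a ->].
  rewrite big1 => [|j _]; first by rewrite (last_vars_mderiv _ (@Mp1_last i)) meval0.
  by rewrite eq_sym ix_neq mulr0.
rewrite (bigD1 a) //= eqxx mulr1 mxE big1 ?addr0 // => j ne.
by rewrite eq_ixr (negPf ne) mulr0.
Qed.

Lemma rank_Bmat_n1 : (exists i, (tnth T i).@[x] != 0) -> (0 < \rank Bmat)%N.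
Proof.
case=> i nz; rewrite lt0n mxrank_eq0; apply/negP => /eqP B0.
have := Bmat_euler i; rewrite B0 big1 => [/esym/eqP|j _]; last by rewrite mxE mulr0.
by rewrite !mulf_eq0 (negPf nz) (negPf dpred_nz) (negPf good_p1_nz).
Qed.

Lemma quadratic_hess0 j j' :
  (\sum_i tnth T i * good_p1 * 'X_(ixl i))^`M(ixr j)^`M(ixr j').@[x] = 0.
Proof.
rewrite (raddf_sum (mderiv (ixr j))) (raddf_sum (mderiv (ixr j'))).
rewrite (raddf_sum (meval x)) big1 // => i _ /=.
move: (tnth T i * good_p1) => q.
have X0 b : ('X_(ixl i) : {mpoly k[N]})^`M(ixr b) = 0.
  by rewrite mderivXU ix_neq.
by rewrite mderivM X0 mulr0 addr0 mderivM X0 mulr0 addr0 mevalM mevalXU xl mulr0.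
Qed.

Lemma good_data_exists : exists P, is_pdata ((T, P) : pdata k (t + s) t n d) /\
  (\rank Bmat + s <= \rank (hess (pform ((T, P) : pdata k (t + s) t n d)) x))%N.
Proof.
have [f [g [ginj fgU]]] := full_rank_minor Bmat.
(* A Fermat sum over the indices outside the invertible minor: its Hessian at [x] is diagonal and
   zero exactly at the columns of the minor. *)
pose p0 : {mpoly k[N]} := \sum_(j | j \notin codom g) 'X_(ixr j) ^+ d.
have hp0 : p0 \is d.-homog.
  by apply: rpred_sum => j _; apply: dhomog_Xexp.
have lp0 : in_last_vars t p0.
  rewrite /p0; elim/big_ind: _ => [|p q|j _]; first exact: last_vars0.
    exact: last_varsD.
  exact: last_varsX.
have DP := good_pdata hp0 lp0.
exists (good_P p0); split=> //.
set D := (T, good_P p0) : pdata k (t + s) t n d in DP *.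
have fl i : (pform D)^`M(ixl i) = tnth T i * good_p1.
  rewrite good_pform mderivD (last_vars_mderiv _ lp0) add0r.
  rewrite (raddf_sum (mderiv (ixl i))) (bigD1 i) //= mderivM.
  rewrite (last_vars_mderiv _ (@Mp1_last i)) mul0r add0r.
  rewrite mderivXU eqxx mulr1.
  rewrite big1 ?addr0 // => i' ne; rewrite mderivM.
  rewrite (last_vars_mderiv _ (@Mp1_last i')) mul0r add0r.
  by rewrite mderivXU eq_ixl (negPf ne) mulr0.
pose c j : k := if j \in codom g then 0 else (d * d.-1)%:R * x (ixr j) ^+ d.-2.
apply: (rank_bordered (c := c) ginj fgU).
- by move=> i i'; rewrite mxE fl (last_vars_mderiv _ (@Mp1_last i)) meval0.
- by move=> i j; rewrite !mxE fl.
- by move=> i j; rewrite -hess_tr !mxE fl.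
- move=> j j'; rewrite mxE good_pform !mderivD mevalD.
  rewrite [X in _ + X]quadratic_hess0 addr0.
  rewrite (raddf_sum (mderiv (ixr j))) (raddf_sum (mderiv (ixr j'))).
  rewrite (raddf_sum (meval x)) /=.
  rewrite /c; have [jg|jg] := ifPn.
    rewrite mul0rn big1 // => a ag.
    rewrite mderiv_Xexp eq_ixr (_ : (a == j) = false) ?mderiv0 ?meval0 //.
    by apply: contraNF ag => /eqP ->.
  rewrite (bigD1 j) //= big1 ?addr0 => [|a /andP[_ ne]]; last first.
    by rewrite mderiv_Xexp eq_ixr (negPf ne) mderiv0 meval0.
  rewrite mderiv_Xexp eqxx mulr1n mderivZ mderiv_Xexp eq_ixr.
  by rewrite mevalZ mevalMn mevalZ rmorphXn /= mevalXU mulrnAr natrM mulrA.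
move=> j; rewrite /c; have [//|_] := ifPn; first by rewrite eqxx.
apply/negbTE; rewrite mulf_neq0 ?expf_neq0 // (pcharf0P _).1 // -lt0n.
by rewrite muln_gt0; lia.
Qed.

End GoodData.

(** * Generic data *)

Section PolynomialFamilies.
Variables (k : closedFieldType) (I N : nat).

(** Polynomials whose coefficients depend polynomially on the parameter [v]. *)
Definition poly_family (G : ('I_I -> k) -> {mpoly k[N]}) : Prop :=
  exists Gam : {mpoly {mpoly k[I]}[N]}, forall v, G v = map_mpoly (meval v) Gam.

Lemma poly_family_const p : poly_family (fun=> p).
Proof.
exists (map_mpoly (@mpolyC I k) p) => v.
by apply/mpolyP => m; rewrite !mcoeff_map_mpoly /= mevalC.
Qed.

Lemma poly_family_coef s : poly_family (fun v => (v s)%:MP).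
Proof. by exists ('X_s)%:MP => v; rewrite map_mpolyC /= mevalXU. Qed.

Lemma poly_familyM G H : poly_family G -> poly_family H ->
  poly_family (fun v => G v * H v).
Proof. by move=> [P PE] [Q QE]; exists (P * Q) => v; rewrite PE QE rmorphM. Qed.

Lemma poly_familyX G e : poly_family G -> poly_family (fun v => G v ^+ e).
Proof. by move=> [P PE]; exists (P ^+ e) => v; rewrite PE rmorphXn. Qed.

Lemma poly_family_sum (J : finType) (G : J -> ('I_I -> k) -> {mpoly k[N]}) :
  (forall j, poly_family (G j)) -> poly_family (fun v => \sum_j G j v).
Proof.
move=> /fin_all_exists[P PE]; exists (\sum_j P j) => v.
by rewrite rmorph_sum; apply: eq_bigr => j _; rewrite PE.
Qed.

Lemma poly_family_mderiv G i : poly_family G -> poly_family (fun v => (G v)^`M(i)).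
Proof.
move=> [P PE]; exists P^`M(i) => v; rewrite PE; apply/mpolyP => m.
by rewrite mcoeff_map_mpoly !mcoeff_deriv mcoeff_map_mpoly /= mevalMn.
Qed.

Lemma poly_family_eval G x : poly_family G ->
  exists q : {mpoly k[I]}, forall v, (G v).@[x] = q.@[v].
Proof.
move=> [P PE]; exists (P.@[fun i => (x i)%:MP]) => v; rewrite PE.
elim/mpoly_ring_ind: P {PE} => [c|i|p q IHp IHq|p q IHp IHq].
- by rewrite map_mpolyC !mevalC.
- by rewrite map_mpolyX !mevalXU mevalC.
- by rewrite rmorphD /= !mevalD IHp IHq.
- by rewrite rmorphM /= !mevalM IHp IHq.
Qed.

Lemma poly_family_det G q x (U : 'M[k]_(q, N)) (V : 'M[k]_(N, q)) :
    poly_family G ->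
  exists p : {mpoly k[I]}, forall v, p.@[v] = \det (U *m hess (G v) x *m V).
Proof.
move=> hG.
have /fin_all_exists[h hE] : forall i, exists h : 'I_N -> {mpoly k[I]},
    forall j v, (hess (G v) x) i j = (h j).@[v].
  move=> i; apply: (@fin_all_exists _ (fun=> _) (fun j (h : {mpoly k[I]}) =>
    forall v, (hess (G v) x) i j = h.@[v])) => j.
  have [p pE] := poly_family_eval x (poly_family_mderiv j (poly_family_mderiv i hG)).
  by exists p => v; rewrite mxE pE.
exists (\det (map_mx (@mpolyC I k) U *m (\matrix_(i, j) h i j) *m
              map_mx (@mpolyC I k) V)) => v.
rewrite -det_map_mx !map_mxM /=; congr (\det (_ *m _ *m _)).
- by apply/matrixP => i j; rewrite !mxE mevalC.
- by apply/matrixP => i j; rewrite 2!mxE hE.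
- by apply/matrixP => i j; rewrite !mxE mevalC.
Qed.

End PolynomialFamilies.

Section Closed.
Variable k : closedFieldType.
Hypothesis char0 : [pchar k] =i pred0.

Lemma eq_zariski_closed I (B : ('I_I -> k) -> Prop) v w :
  zariski_closed B -> v =1 w -> B v -> B w.
Proof.
by case=> S SE vw /SE Bv; apply/SE => p /Bv <-; apply/esym/meval_eq.
Qed.

(** Some equation of A is not identically zero on the line. Each equation of B vanishes wherever
    that one does not, hence on the whole line and so at [u]. *)
Lemma zariski_closed_line I (A B : ('I_I -> k) -> Prop) u v t0 :
    zariski_closed A -> zariski_closed B ->
    ~ A (fun i => u i + t0 * v i) ->
    (forall t, ~ A (fun i => u i + t * v i) -> B (fun i => u i + t * v i)) ->
  B u.
Proof.
move=> [S SE] clB nA AB; have [S' SE'] := clB.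
have [p [Sp pnz]] : exists p, S p /\ p.@[fun i => u i + t0 * v i] <> 0.
  apply: NNPP => H; apply: nA; apply/SE => p Sp; apply: NNPP => pnz.
  by apply: H; exists p.
apply/SE' => q S'q.
have Z : forall c, q.@[fun i => u i + c * v i] = 0.
  apply: (line_irreducible char0 (p := p) (t0 := t0)); first exact/eqP.
  move=> t pt; apply: (SE' _).1 q S'q; apply: AB.
  by move/SE/(_ p Sp)/eqP; rewrite (negPf pt).
by apply: etrans (Z 0); apply: meval_eq => i; rewrite mul0r addr0.
Qed.

End Closed.

(** * Coefficient vectors, the bad set, and lines in the space of data *)

Section Coefficients.
Variable k : closedFieldType.
Hypothesis char0 : [pchar k] =i pred0.
Variables (t s n d : nat).
Hypothesis n1 : (1 <= n)%N.
Hypothesis n_lt_d : (n < d)%N.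
Local Notation r := (t + s)%N.
Local Notation I := #|coef_index r t n d|.

(** A left inverse of [coefs] on genuine data; it is defined on every vector so that the bad set is
    a closed subset of the whole affine space. *)
Definition decode (v : 'I_I -> k) : pdata k r t n d :=
  ([tuple \sum_(m : 'X_{1..r.+1 < d.+1})
      v (enum_rank ((inl i, m) : coef_index r t n d)) *: 'X_[m] | i < t.+1],
   [tuple \sum_(m : 'X_{1..r.+1 < d.+1})
      v (enum_rank ((inr j, m) : coef_index r t n d)) *: 'X_[m] | j < (d %/ n).+1]).

Lemma dhomog_expand e (p : {mpoly k[r.+1]}) : (e <= d)%N -> p \is e.-homog ->
  \sum_(m : 'X_{1..r.+1 < d.+1}) p@_m *: 'X_[m] = p.
Proof.
move=> le hp; rewrite -mpolywE // /mmeasure; apply/bigmax_leqP_seq => m mp _.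
by rewrite ltnS (leq_trans _ le) // (dhomog_mf hp mp).
Qed.

Lemma coefsK (D : pdata k r t n d) : is_pdata D -> decode (coefs D) = D.
Proof.
move=> DP; case: D DP => T P DP; congr (_, _); apply: eq_from_tnth => i.
  rewrite tnth_mktuple -[RHS](@dhomog_expand (n - 1)); first last.
  - exact: M_homog DP i.
  - lia.
  by apply: eq_bigr => m _; rewrite /coefs enum_rankK.
rewrite tnth_mktuple -[RHS](@dhomog_expand (d - i * n)) ?leq_subr //; last first.
  exact: P_homog DP i.
by apply: eq_bigr => m _; rewrite /coefs enum_rankK.
Qed.

Lemma poly_family_decode : poly_family (fun v => pform (decode v)).
Proof.
have fam a : poly_family (fun v : 'I_I -> k =>
    \sum_(m : 'X_{1..r.+1 < d.+1})
      v (enum_rank ((a, m) : coef_index r t n d)) *: 'X_[m]).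
  apply: poly_family_sum => m.
  have [G GE] := poly_familyM
    (@poly_family_coef k I r.+1 (enum_rank ((a, m) : coef_index r t n d)))
    (poly_family_const I 'X_[m]).
  by exists G => v; rewrite -GE mul_mpolyC.
apply: poly_family_sum => j; apply: poly_familyM.
  apply: poly_familyX; apply: poly_family_sum => i; apply: poly_familyM.
    have [G GE] := fam (inl i); exists G => v; rewrite -GE tnth_mktuple //.
  exact: poly_family_const.
by have [G GE] := fam (inr j); exists G => v; rewrite -GE tnth_mktuple.
Qed.

Definition bad q (v : 'I_I -> k) : Prop :=
  forall x (U : 'M[k]_(q, r.+1)) (V : 'M[k]_(r.+1, q)),
    \det (U *m hess (pform (decode v)) x *m V) = 0.

Lemma bad_closed q : zariski_closed (bad q).
Proof.
(* The equations are all polynomials representing such a determinant as a function of [v]. *)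
exists (fun p => exists x (U : 'M[k]_(q, r.+1)) (V : 'M[k]_(r.+1, q)),
  forall v, p.@[v] = \det (U *m hess (pform (decode v)) x *m V)).
move=> v; split=> [bv p [x [U [V pE]]]|H x U V]; first by rewrite pE.
have [p pE] := poly_family_det x U V poly_family_decode.
by rewrite -pE; apply: H; exists x, U, V.
Qed.

Lemma not_bad q (D : pdata k r t n d) : is_pdata D ->
  ~ bad q (coefs D) <-> exists x, (q <= \rank (hess (pform D) x))%N.
Proof.
move=> DP; split=> [nb|[x /rank_factor[U [V E]]] b].
  apply: NNPP => H; apply: nb => x U V; rewrite coefsK //; apply/eqP.
  by apply: contraT => /leq_rank_det nz; case: H; exists x.
have := b x U V; rewrite coefsK // E det1 => /eqP.
by rewrite oner_eq0.
Qed.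

Definition padd (D : pdata k r t n d) (c : k) (D' : pdata k r t n d) :
    pdata k r t n d :=
  ([tuple tnth D.1 i + c *: tnth D'.1 i | i < t.+1],
   [tuple tnth D.2 j + c *: tnth D'.2 j | j < (d %/ n).+1]).

Lemma coefs_padd D c D' a : coefs (padd D c D') a = coefs D a + c * coefs D' a.
Proof.
rewrite /coefs; case: (enum_val a) => -[i|j] m;
by rewrite tnth_mktuple mcoeffD mcoeffZ.
Qed.

Lemma padd_line (A B : ('I_I -> k) -> Prop) D D' c0 :
    zariski_closed A -> zariski_closed B ->
    ~ A (coefs (padd D c0 D')) ->
    (forall c, ~ A (coefs (padd D c D')) -> B (coefs (padd D c D'))) ->
  B (coefs D).
Proof.
move=> clA clB nA AB.
apply: (zariski_closed_line char0 (v := coefs D') (t0 := c0) clA clB).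
  by move=> H; apply: nA; apply: eq_zariski_closed clA _ H => a; rewrite coefs_padd.
move=> c nAc; apply: (eq_zariski_closed clB (v := coefs (padd D c D'))).
  by move=> a; rewrite coefs_padd.
apply: AB => H; apply: nAc; apply: eq_zariski_closed clA _ H => a.
by rewrite coefs_padd.
Qed.

(** The punctured line is dense in the line, so D may be replaced by small perturbations of it. *)
Lemma padd_limit (B : ('I_I -> k) -> Prop) D D' : zariski_closed B ->
  (forall c, c != 0 -> B (coefs (padd D c D'))) -> B (coefs D).
Proof.
move=> [S SE] H; apply/SE => p Sp.
have [q qE] := mpoly_line p (coefs D) (coefs D').
suff q0 : q = 0.
  have := qE 0; rewrite q0 horner0 => ->.
  by apply: meval_eq => a; rewrite mul0r addr0.
apply/eqP; apply: contraT => nz.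
have [|c] := poly_nonroot char0 (q := q * 'X); first by rewrite mulf_neq0 ?polyX_eq0.
rewrite hornerM hornerX mulf_eq0 negb_or qE => /andP[+ cnz].
have := (SE _).1 (H c cnz) p Sp => E.
by rewrite -(meval_eq _ (coefs_padd D c D')) E eqxx.
Qed.

End Coefficients.

(** * Density of the good data *)

Section Density.
Variable k : closedFieldType.
Hypothesis char0 : [pchar k] =i pred0.
Variables (t s n d : nat).
Hypothesis s1 : (1 <= s)%N.
Hypothesis t1 : (1 <= t)%N.
Hypothesis n1 : (1 <= n)%N.
Hypothesis n_lt_d : (n < d)%N.
Local Notation r := (t + s)%N.
Local Notation N := r.+1.
Local Notation I := #|coef_index r t n d|.
Local Notation ixl := (@ixl t s).
Local Notation ixr := (@ixr t s).
Local Notation data := (pdata k r t n d).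
Local Notation rho := (target_rank t s n).

Variable B : ('I_I -> k) -> Prop.
Hypothesis clB : zariski_closed B.
Hypothesis goodB : forall D : data, is_pdata D -> ~ bad rho (coefs D) -> B (coefs D).

Definition zeroP : (d %/ n).+1.-tuple {mpoly k[N]} := [tuple 0 | _ < (d %/ n).+1].

Lemma padd_fst_pdata (D : data) c (T' : t.+1.-tuple {mpoly k[N]}) : is_pdata D ->
    (forall i, tnth T' i \is (n - 1).-homog /\ in_last_vars t (tnth T' i)) ->
    alg_dependent (padd D c ((T', zeroP) : data)).1 ->
  is_pdata (padd D c ((T', zeroP) : data)).
Proof.
move=> [DT _ DP] T'P dep; split=> // [i|j]; rewrite tnth_mktuple.
  have [[h1 l1] [h2 l2]] := (DT i, T'P i); split.
    by apply: rpredD => //; apply: rpredZ.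
  by apply: last_varsD => //; apply: last_varsZ.
by rewrite tnth_mktuple scaler0 addr0; apply: DP.
Qed.

(** Only the [P_j] move here: they are subject to no relation, so the line from D to the good data
    with the same [M_i] consists of admissible data. *)
Lemma good_forms (D : data) x : is_pdata D ->
    (forall i, x (ixl i) = 0) -> (forall j, x (ixr j) != 0) ->
    (if n == 1%N then exists i, (tnth D.1 i).@[x] != 0
     else (minn t s <= \rank (jac (tnth D.1) x))%N) ->
  B (coefs D).
Proof.
move=> DP xl xr Hx; have [DT dep DPP] := DP.
have [P [PP rk]] := good_data_exists char0 s1 n1 n_lt_d DT dep xl xr.
have rk' : (rho <= \rank (hess (pform ((D.1, P) : data)) x))%N.
  apply: leq_trans rk; move: Hx; rewrite /target_rank; case: eqP => _ Hx.
    by have := rank_Bmat_n1 char0 s1 n1 n_lt_d DT xl xr Hx; lia.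
  have := leq_trans Hx (rank_jac_Bmat char0 s1 n1 n_lt_d DT xl xr); lia.
pose D' : data := ([tuple 0 | _ < t.+1],
                   [tuple tnth P j - tnth D.2 j | j < (d %/ n).+1]).
have E1 c : (padd D c D').1 = D.1.
  by apply: eq_from_tnth => i; rewrite !tnth_mktuple scaler0 addr0.
have E : padd D 1 D' = (D.1, P).
  rewrite [LHS]surjective_pairing E1; congr (_, _); apply: eq_from_tnth => j.
  by rewrite !tnth_mktuple scale1r addrC subrK.
apply: (padd_line char0 (c0 := 1) (D' := D') (bad_closed k t s n d rho) clB).
  by rewrite E; apply/not_bad => //; exists x.
move=> c; apply: goodB; split; rewrite ?E1 // => j.
rewrite !tnth_mktuple; have [_ _ /(_ j)[h1 l1]] := PP; have [h2 l2] := DPP j.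
split.
  by apply: rpredD => //; apply: rpredZ; rewrite rpredB.
apply: last_varsD => //; apply: last_varsZ; apply: last_varsD => //.
by rewrite -scaleN1r; apply: last_varsZ.
Qed.

Lemma jac_last_vars (T : t.+1.-tuple {mpoly k[N]}) v w :
    (forall i, in_last_vars t (tnth T i)) -> (forall j, v (ixr j) = w (ixr j)) ->
  jac (tnth T) v = jac (tnth T) w.
Proof.
move=> lT vw; apply/matrixP => i l; rewrite !mxE.
by apply: last_vars_eval vw; apply: last_vars_deriv.
Qed.

Lemma prodX_nz : \prod_j 'X_(ixr j) != 0 :> {mpoly k[N]}.
Proof. by apply/prodf_neq0 => j _; rewrite -msize_poly_eq0 msizeX. Qed.

(* If the Jacobian of [M] has generic rank below [min t s], any [t] of the [M_i]
   are already dependent, so one redundant [M_i] can be perturbed freely. *)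
Lemma good_maps m (D : data) w : n != 1%N -> is_pdata D ->
    (forall j, w (ixr j) != 0) ->
    (minn t s <= m + \rank (jac (tnth D.1) w))%N ->
  B (coefs D).
Proof.
(* The induction is on [m], a bound for the rank still missing. *)
move=> nE; elim: m D w => [|m IHm] D w DP wr rk.
  apply: (good_forms (x := glue (fun=> 0) (fun j => w (ixr j))) DP).
  - by move=> i; rewrite glue_ixl.
  - by move=> j; rewrite glue_ixr.
  rewrite (negPf nE) (jac_last_vars (w := w)) //; first exact: M_last DP.
  by move=> j; rewrite glue_ixr.
case: (classic (exists w', (forall j, w' (ixr j) != 0) /\
    (minn t s <= m + \rank (jac (tnth D.1) w'))%N)) => [[w' [w'r rk']]|H].
  exact: IHm DP w'r rk'.
set J := jac (tnth D.1) w in rk.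
have ltJ : (m + \rank J < minn t s)%N.
  by rewrite ltnNge; apply/negP => le; apply: H; exists w.
have max v : (\rank (jac (tnth D.1) v) <= \rank J)%N.
  rewrite leqNgt; apply/negP => lt.
  have [w' [rw' nz]] := jac_rank_generic char0 lt prodX_nz.
  apply: H; exists w'; split; last by move: rk rw'; lia.
  move=> j; move: nz; rewrite rmorph_prod /= => /prodf_neq0/(_ j isT).
  by rewrite mevalXU.
pose f := maxrankfun J.
(* A row outside a chosen basis of rows of [J]: changing [M_i] leaves that basis intact. *)
have [i fi] : exists i, i \notin codom f.
  apply: NNPP => nE'.
  have : (#|'I_t.+1| <= #|codom f|)%N.
    apply: subset_leq_card; apply/subsetP => i _.
    by apply: contraT => fi; case: nE'; exists i.
  move/leq_trans/(_ (leq_image_card f predT)); rewrite !card_ord => le.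
  by move: ltJ; lia.
have fJ : (rowsub f J :=: J)%MS := eq_maxrowsub J.
have [F [Fnz F0]] : algdep (fun a : 'I_t => tnth D.1 (lift i a)).
  apply: NNPP => /(jacobian_criterion char0)[v fr].
  have := mxrankM_maxr (rowsub (lift i) 1%:M) (jac (tnth D.1) v).
  rewrite mul_rowsub_mx mul1mx => le.
  have Ej : rowsub (lift i) (jac (tnth D.1) v) =
            jac (fun a : 'I_t => tnth D.1 (lift i a)) v.
    by apply/matrixP => a b; rewrite !mxE.
  by move: le (max v); rewrite Ej (eqP fr); move: ltJ; lia.
(* The rank is below s, so some differential [dx_l] of a last variable is missing from the row
   space. *)
have [l lJ] : exists l : 'I_s, ~~ ((delta_mx 0 (ixr l) : 'rV[k]_N) <= J)%MS.
  apply: NNPP => nE'.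
  pose E : 'M[k]_(s, N) := \matrix_(j, b) (ixr j == b)%:R.
  have EJ : (E <= J)%MS.
    apply/row_subP => j; have -> : row j E = delta_mx 0 (ixr j).
      by apply/rowP => b; rewrite !mxE eq_sym.
    by apply: contraT => nl; case: nE'; exists j.
  have fE : row_free E.
    apply/row_freeP; exists E^T; apply/matrixP => a b; rewrite !mxE.
    rewrite (bigD1 (ixr a)) //= !mxE eqxx mul1r eq_sym eq_ixr big1 ?addr0.
      by rewrite eq_sym.
    by move=> c ne; rewrite !mxE eq_sym (negPf ne) mul0r.
  by have := mxrankS EJ; rewrite (eqP fE); move: ltJ; lia.
(* At [w] the differential of [x_l ^ (n - 1)] is a non-zero multiple of [dx_l], so adding a multiple
   of this power to [M_i] gains one rank. The relation [F] between the other [M_a] keeps the tuple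
   dependent. *)
pose T' : t.+1.-tuple {mpoly k[N]} :=
  [tuple if i' == i then 'X_(ixr l) ^+ (n - 1) else 0 | i' < t.+1].
pose D' : data := (T', zeroP).
have n2 : (0 < n - 1)%N by lia.
apply: (padd_limit char0 (D' := D') clB) => c cnz.
apply: (IHm _ w) => //.
  apply: padd_fst_pdata => // [i'|].
    rewrite tnth_mktuple; case: eqP => _; last first.
      by split; [exact: dhomog0 | exact: last_vars0].
    by split; [exact: dhomog_Xexp | exact: last_varsX].
  exists (msubst (fun a => 'X_(lift i a)) F); split.
    have [v vF] := mpoly_nonroot char0 Fnz.
    pose v' j := if unlift i j is Some a then v a else 0.
    suff : (msubst (fun a => 'X_(lift i a)) F).@[v'] != 0.
      by apply: contraNneq => ->; rewrite meval0.
    rewrite meval_msubst; apply: contraNneq vF => <-; apply/eqP.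
    by apply: meval_eq => a; rewrite mevalXU /v' liftK.
  apply: (mpoly_eq0P char0) => v; rewrite comp_msubst !meval_msubst.
  have := congr1 (meval v) F0; rewrite meval0 meval_msubst; apply: etrans.
  apply: meval_eq => a; rewrite mevalXU !tnth_mktuple.
  by rewrite eq_sym (negPf (neq_lift i a)) scaler0 addr0.
set Jc := jac _ _.
have JcE : Jc = J + (c * ((n - 1)%:R * w (ixr l) ^+ (n - 2))) *: delta_mx i (ixr l).
  apply/matrixP => a b; rewrite !mxE !tnth_mktuple mderivD mevalD mderivZ mevalZ.
  congr (_ + _); case: (eqVneq a i) => [_|_]; last first.
    by rewrite mderiv0 meval0 !mulr0.
  rewrite mderiv_Xexp mevalMn mevalZ rmorphXn /= mevalXU [b == _]eq_sym.
  by rewrite (_ : (n - 1).-1 = (n - 2)%N) ?mulr_natr ?mulrnAr //; lia.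
set e := (c * _) in JcE.
have enz : e != 0.
  by rewrite !mulf_neq0 ?expf_neq0 // (pcharf0P _).1 // -lt0n.
have fJc : rowsub f Jc = rowsub f J.
  apply/matrixP => a b; rewrite [LHS]mxE [RHS]mxE JcE.
  rewrite [LHS]mxE [X in _ + X]mxE [delta_mx _ _ _ _]mxE.
  have -> : (f a == i) = false by apply: contraNF fi => /eqP <-; apply: codom_f.
  by rewrite mulr0 addr0.
have sJ : (J <= Jc)%MS.
  rewrite -fJ -fJc; apply/row_subP => a; rewrite row_rowsub.
  exact: row_sub.
suff : (\rank J < \rank Jc)%N by move: rk; lia.
rewrite ltn_neqAle mxrankS // andbT; apply: contra lJ => /eqP eJ.
have JcJ : (Jc <= J)%MS by rewrite -(mxrank_leqif_sup sJ) eJ.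
have -> : delta_mx 0 (ixr l) = e^-1 *: (row i Jc - row i J) :> 'rV[k]_N.
  apply/rowP => b; rewrite JcE !mxE !eqxx /= addrAC subrr add0r mulrA.
  by rewrite mulVf // mul1r.
apply: scalemx_sub; apply: addmx_sub; first by apply: submx_trans JcJ; apply: row_sub.
by rewrite eqmx_opp row_sub.
Qed.

Lemma good_dense (D : data) : is_pdata D -> B (coefs D).
Proof.
move=> DP; have [nE|nE] := eqVneq n 1%N; last first.
  apply: (@good_maps (minn t s) D (fun=> 1)) => //; last exact: leq_addr.
  by move=> j; apply: oner_neq0.
pose x := glue (fun=> 0) (fun=> 1) : 'I_N -> k.
have xl i : x (ixl i) = 0 by rewrite /x glue_ixl.
have xr j : x (ixr j) != 0 by rewrite /x glue_ixr oner_neq0.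
have step (D1 : data) : is_pdata D1 -> (exists i, tnth D1.1 i != 0) -> B (coefs D1).
  move=> D1P [i nz]; apply: (good_forms D1P xl xr); rewrite {1}nE eqxx; exists i.
  have [v] := mpoly_nonroot char0 nz.
  by rewrite (M_const D1P i v x nE).
case: (classic (exists i, tnth D.1 i != 0)) => [|H]; first exact: step.
have M0 i : tnth D.1 i = 0.
  by apply/eqP; apply: contraT => nz; case: H; exists i.
(* A zero tuple is the limit of the constant tuples (c, 0, ..., 0), whose last entry is zero because
   t > 0; the last variable is then a relation. *)
pose T' : t.+1.-tuple {mpoly k[N]} := [tuple if i == ord0 then 1 else 0 | i < t.+1].
apply: (padd_limit char0 (D' := ((T', zeroP) : data)) clB) => c cnz.
apply: step; last first.
  exists ord0; rewrite !tnth_mktuple M0 add0r eqxx scaler_eq0 negb_or cnz.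
  exact: oner_neq0.
apply: padd_fst_pdata => // [i|].
  rewrite tnth_mktuple; case: eqP => _; last first.
    by split; [exact: dhomog0 | exact: last_vars0].
  have -> : (n - 1 = 0)%N by lia.
  split; first exact: dhomog1.
  by move=> m; rewrite msupp1 inE => /eqP -> j _; rewrite mnm0E.
exists 'X_ord_max; split; first by rewrite -msize_poly_eq0 msizeX.
rewrite comp_msubst msubstX !tnth_mktuple M0 add0r.
by rewrite -val_eqE /= eqn0Ngt t1 scaler0.
Qed.

End Density.

Theorem proposition2p15 (k : closedFieldType) (r t n d : nat)
    (char0 : [pchar k] =i pred0)
    (r_ge2 : (2 <= r)%N) (t_ge1 : (1 <= t)%N) (t_le : (t <= r - 2)%N)
    (n_ge1 : (1 <= n)%N) (n_lt_d : (n < d)%N) :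
  for_general_pdata (fun D : pdata k r t n d =>
    forall g : 'M[k]_r.+1, g \in unitmx ->
      let f := lin_change g (pform D) in
      vequal (polar_image f) (Wcone D g) /\
      ((n = 1%N -> t = 1%N) ->
         has_dim (polar_image f) (minn (r - 1) (2 * (r - t) - 1)))).
Proof.
have [s rE] : exists s, r = (t + s)%N by exists (r - t)%N; lia.
subst r; have s1 : (1 <= s)%N by lia.
exists (bad (target_rank t s n)); split.
- exact: bad_closed.
- move=> B clB goodB D DP; exact: (good_dense char0 s1 t_ge1 n_ge1 n_lt_d clB goodB DP).
move=> D DP /(not_bad n_ge1 n_lt_d _ DP)[x rk] g gU f.
have [eqZW dimZ] := polar_image_Wcone char0 s1 n_ge1 n_lt_d t_ge1 DP gU rk.
(* For n = 1 the dimension found is s, which equals the minimum of t + s - 1 and 2 s - 1 when t =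
   1. *)
split=> // nt; move: dimZ; congr has_dim.
by rewrite /target_rank; case: eqP nt => [-> /(_ erefl)|_ _]; lia.
Qed.
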